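(* Let $G$ be a connected $n$-vertex graph that is neither a triangle nor a $7$-cycle. Then \[\iota_3(G) \leq \left\lfloor \frac{n}{4} \right\rfloor.\] Moreover, equality holds if $G = B_{n,K_3}$.
   Context: All graphs are finite and simple; $V(G)$ and $E(G)$ denote the vertex set and edge set of $G$. An $n$-vertex graph is a graph with $|V(G)| = n$; connected graphs have $n \geq 1$. For $n \ge 1$, $[n]=\{1,\dots,n\}$, and $[0]=\emptyset$. For $D \subseteq V(G)$, $N[D]$ denotes the closed neighbourhood of $D$ (the set of vertices in $D$ or adjacent to a vertex in $D$), and $G - X$ denotes the graph obtained from $G$ by deleting the vertices in $X$. ''Contains'' refers to (not necessarily induced) subgraphs. For $k \geq 1$, let $\mathcal{E}_k$ be the set of connected graphs that have at least $k$ edges. A set $D \subseteq V(G)$ is an $\mathcal{E}_k$-isolating set of $G$ if $G - N[D]$ contains no copy of a graph in $\mathcal{E}_k$ as a subgraph. $\iota_k(G)$ denotes the size of a smallest $\mathcal{E}_k$-isolating set of $G$. $K_n = ([n], \binom{[n]}{2})$; $P_n = ([n], \{\{i,i+1\} : i \in [n-1]\})$; for $n\ge 3$, $C_n = ([n], E(P_n) \cup \{\{n,1\}\})$. A triangle is a copy (isomorphic image) of $K_3$ and a $7$-cycle is a copy of $C_7$. The graph $B_{n,K_3}$: if $n \leq 3$, $B_{n,K_3} = P_n$. If $n \geq 4$, let $a = \lfloor n/4 \rfloor$ and $b = n - 3a$ (so $a \le b \le a+3$), and let $F_1,\dots,F_a$ be copies of $K_3$ such that $P_b, F_1, \dots,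 F_a$ are pairwise vertex-disjoint. Then $B_{n,K_3}$ has vertex set $[b] \cup \bigcup_{i=1}^a V(F_i)$ and edge set $E(P_a) \cup \{\{a,j\} : j \in [b]\setminus[a]\} \cup \bigcup_{i=1}^a (E(F_i) \cup \{\{i,v\} : v \in V(F_i)\})$. *)

(* Defs.v *)
(* Finite simple graphs over MathComp finite types. *)
From mathcomp Require Import all_boot.
From mathcomp Require Import boolp.

Set Implicit Arguments.
Unset Strict Implicit.
Unset Printing Implicit Defensive.

Record sgraph := SGraph {
  vertex :> finType;
  adj : rel vertex;
  adj_sym : symmetric adj;
  adj_irr : irreflexive adj }.
Arguments adj {s}.

Definition sym_rel (T : eqType) (r : rel T) : rel T :=
  fun x y => (x != y) && (r x y || r y x).

Lemma sym_rel_sym (T : eqType) (r : rel T) : symmetric (sym_rel r).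
Proof. by move=> x y; rewrite /sym_rel eq_sym orbC. Qed.

Lemma sym_rel_irr (T : eqType) (r : rel T) : irreflexive (sym_rel r).
Proof. by move=> x; rewrite /sym_rel eqxx. Qed.

(* The graph with edges {x, y} for x != y such that r x y or r y x. *)
Definition graph_of_rel (T : finType) (r : rel T) : sgraph :=
  SGraph (sym_rel_sym r) (sym_rel_irr r).

Definition edges (G : sgraph) : {set {set G}} :=
  [set [set p.1; p.2] | p : G * G & adj p.1 p.2].

Definition connected (G : sgraph) : Prop :=
  0 < #|G| /\ forall x y : G, connect adj x y.

Definition isomorphic (G H : sgraph) : Prop :=
  exists2 f : G -> H, bijective f & {mono f : x y / adj x y}.

(* G has a (not necessarily induced) subgraph that is a copy of H. *)
Definition contains_copy (G H : sgraph) : Prop :=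
  exists2 f : H -> G, injective f & {homo f : x y / adj x y}.

Definition closed_nbhd (G : sgraph) (D : {set G}) : {set G} :=
  [set y | (y \in D) || [exists x in D, adj x y]].

Definition del_adj (G : sgraph) (X : {set G}) : rel {x : G | x \notin X} :=
  fun u v => adj (val u) (val v).

Lemma del_adj_sym (G : sgraph) (X : {set G}) : symmetric (@del_adj G X).
Proof. by move=> u v; apply: adj_sym. Qed.

Lemma del_adj_irr (G : sgraph) (X : {set G}) : irreflexive (@del_adj G X).
Proof. by move=> u; apply: adj_irr. Qed.

Definition del_vertices (G : sgraph) (X : {set G}) : sgraph :=
  SGraph (@del_adj_sym G X) (@del_adj_irr G X).

Definition E_family (k : nat) (H : sgraph) : Prop :=
  connected H /\ k <= #|edges H|.

Definition isolating (k : nat) (G : sgraph) (D : {set G}) : Prop :=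
  forall H : sgraph, E_family k H ->
    ~ contains_copy (del_vertices (closed_nbhd D)) H.

Lemma isolating_setT (k : nat) (G : sgraph) : isolating k [set: G].
Proof.
move=> H [[/card_gt0P[x _] _] _] [f _ _].
by have := valP (f x); rewrite inE in_setT.
Qed.

(* The minimum is over a nonempty family of sets, by isolating_setT. *)
Definition isolation_number (k : nat) (G : sgraph) : nat :=
  #|[arg min_(D < [set: G] | `[< isolating k D >]) #|D| ]|.

(* The vertex set [n] = {1, ..., n} is encoded as 'I_n = {0, ..., n-1}. *)
Definition complete_graph (n : nat) : sgraph :=
  graph_of_rel (fun _ _ : 'I_n => true).

Definition path_graph (n : nat) : sgraph :=
  graph_of_rel (fun i j : 'I_n => i.+1 == j :> nat).

(* Only meaningful for n >= 3. *)
Definition cycle_graph (n : nat) : sgraph :=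
  graph_of_rel (fun i j : 'I_n =>
    (i.+1 == j :> nat) || ((i.+1 == n) && (j == 0 :> nat))).

(* inl i is vertex i+1 of [b]; inr (i, v) is vertex v of F_(i+1). *)
Definition BK3_rel (a b : nat) : rel ('I_b + 'I_a * complete_graph 3) :=
  fun x y => match x, y with
  | inl i, inl j => ((i.+1 == j :> nat) && (j < a)) || ((i.+1 == a) && (a <= j))
  | inl i, inr (i', _) => i == i' :> nat
  | inr _, inl _ => false
  | inr (i, u), inr (i', v) => (i == i') && adj u v
  end.

Definition BK3 (n : nat) : sgraph :=
  if n <= 3 then path_graph n
  else graph_of_rel (@BK3_rel (n %/ 4) (n - 3 * (n %/ 4))).

(* Main.v *)
Require Import Defs.
From mathcomp Require Import all_boot.
From mathcomp Require Import boolp zify.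

(** A set of vertices is isolating here when each component left over is a
    single vertex, an edge, or a path with two edges ([sparse]).

    Upper bound.  The statement is proved for connected vertex subsets [S] of a
    fixed graph that are not exceptional, that is, do not induce a triangle or a
    7-cycle ([connected_isolable]).  Consider a minimal counterexample [S].  If
    one vertex dominates a set [X] of at least four vertices of [S], the
    components of [S - X] can be isolated separately by minimality, and even
    exceptional components cost only a quarter of their size once one of their
    vertices is dominated: what remains of a triangle is an edge, and what
    remains of a 7-cycle is a 6-vertex path, handled by one vertex.  So the only
    obstruction is an exceptional component that no chosen vertex dominates
    ([removal]).  An exceptional component dominated in this way even leaves three vertices to
    spare, so a single vertex [x] pays for itself if [S - x] has an exceptional
    component; hence there is none ([no_exceptional_branch]).

    Let [v] have at least three neighbours.  Removing [v] and its neighbours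
    leaves an exceptional component [H], which sees at least two neighbours of
    [v].  For each edge from a neighbour [x] of [v] to a vertex [y] of [H],
    removing [x], [y] and the two neighbours of [y] on [H] leaves an exceptional
    component, the piece at [(x, y)]; it has to contain [v], so [v] has degree
    exactly three ([piece_ex], [degree3]).  Hence all degrees are at most three,
    and this rigidity makes every piece disjoint from [H] ([piece_disjoint]) and
    leaves each neighbour of [v] at most one link to [H] ([single_link]).
    Removing the closed neighbourhood of a linked neighbour of [v] instead of
    that of [v] then produces no acceptable exceptional component
    ([no_branching]).  So all degrees are at most two, [S] is a path or a cycle,
    and dominators can be placed explicitly ([isolable_degree2]).

    Lower bound.  In the extremal graph, an isolating set must meet each of the
    [n %/ 4] disjoint blocks formed by a triangle and its attachment vertex,
    because the neighbourhood of the triangle stays in its block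
    ([BK3_lower]). *)

Set Implicit Arguments.
Unset Strict Implicit.
Unset Printing Implicit Defensive.

(** * Small finite sets *)

Section FiniteSets.
Variable T : finType.
Implicit Types (A : {set T}) (a b c : T).

Lemma uniq_size_card A (s : seq T) : uniq s -> all (mem A) s -> size s <= #|A|.
Proof.
move=> us /allP sA; rewrite -(card_uniqP us); apply/subset_leq_card/subsetP.
exact: sA.
Qed.

Lemma card2_mem A a b c :
  #|A| <= 2 -> a \in A -> b \in A -> a != b -> c \in A -> c = a \/ c = b.
Proof.
move=> A2 aA bA ab cA; case: (eqVneq c a) => [->|ca]; first by left.
case: (eqVneq c b) => [->|cb]; first by right.
have := @uniq_size_card A [:: a; b; c]; rewrite /= !inE aA bA cA negb_or.
by rewrite ab (eq_sym a) ca (eq_sym b) cb => /(_ isT isT); lia.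
Qed.

Lemma card2_other A a : 1 < #|A| -> exists2 b, b \in A & b != a.
Proof.
case: (pselect (exists2 b, b \in A & b != a)) => // no A2.
suff: #|A| <= #|[set a]| by rewrite cards1 leqNgt A2.
apply/subset_leq_card/subsetP => b bA; rewrite inE.
by apply: contra_notT no => ba; exists b.
Qed.

End FiniteSets.

(** * Connected, exceptional and sparse vertex sets *)

Section Sets.
Variable G : sgraph.
Implicit Types (x y z u v w : G) (A D K R S X : {set G}) (s : seq G).

Definition nbrs S x : {set G} := [set y in S | adj x y].

(** Connectivity is phrased through closed subsets instead of walks, because the
    arguments below either exhibit a closed subset or follow an edge leaving
    one. *)
Definition conn_set K : Prop :=
  (exists x, x \in K) /\
  forall A x, x \in K -> x \in A ->
    (forall y z, y \in K -> y \in A -> z \in K -> adj y z -> z \in A) ->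
  K \subset A.

Definition component R K : Prop :=
  [/\ K \subset R, conn_set K &
      forall x y, x \in K -> y \in R -> adj x y -> y \in K].

(** The vertex sets that induce a triangle or a 7-cycle; counting neighbours
    avoids naming the vertices until an explicit cycle is wanted. *)
Definition exceptional K : Prop :=
  [/\ #|K| = 3 \/ #|K| = 7, conn_set K & forall x, x \in K -> #|nbrs K x| = 2].

(** A local form of having at most two edges in every component: if [a b c] is
    a path, no further edge leaves [a] or [b], nor [c] by reversing the path. *)
Definition sparse R : Prop :=
  forall a b c d, a \in R -> b \in R -> c \in R -> d \in R ->
    a != c -> adj a b -> adj b c ->
    (adj a d -> d = b) /\ (adj b d -> d = a \/ d = c).

(** The dominators may lie outside [S].  This is harmless since only
    non-dominated vertices matter, and it lets dominators of different parts be
    merged freely. *)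
Definition isolable S : Prop :=
  exists2 D : {set G}, 4 * #|D| <= #|S| & sparse (S :\: closed_nbhd D).

Lemma in_nbrs S x y : (y \in nbrs S x) = (y \in S) && adj x y.
Proof. by rewrite inE. Qed.

Lemma nbhd_in D d : d \in D -> d \in closed_nbhd D.
Proof. by rewrite inE => ->. Qed.

Lemma nbhd_adj D d y : d \in D -> adj d y -> y \in closed_nbhd D.
Proof.
by move=> dD dy; rewrite inE; apply/orP; right; apply/existsP; exists d; rewrite dD.
Qed.

Lemma nbhdS D D' : D \subset D' -> closed_nbhd D \subset closed_nbhd D'.
Proof.
move=> DD'; apply/subsetP => y; rewrite inE => /orP[yD|/existsP[d /andP[dD dy]]].
  exact/nbhd_in/(subsetP DD').
exact: (nbhd_adj (subsetP DD' _ dD)).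
Qed.

Lemma nbhd1E u w : (w \in closed_nbhd [set u]) = (w == u) || adj u w.
Proof.
rewrite !inE; congr (_ || _); apply/existsP/idP => [[d /andP[]]|uw].
  by rewrite inE => /eqP->.
by exists u; rewrite inE eqxx.
Qed.

(** The component is a smallest subset of [R] that contains [x] and is closed
    under adjacency in [R]: a proper closed part of it would itself, or by its
    complement, give a smaller one. *)
Lemma component_ex R x : x \in R -> exists2 K, component R K & x \in K.
Proof.
move=> xR.
pose P K := [&& K \subset R, x \in K &
  [forall y in K, forall z in R, adj y z ==> (z \in K)]].
have PR : P R.
  rewrite /P subxx xR /=; apply/forall_inP => y _; apply/forall_inP => z zR.
  by rewrite zR implybT.
case: (arg_minnP (fun K : {set G} => #|K|) PR) => K /and3P[KR xK Kcl] Kmin.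
have cl y z : y \in K -> z \in R -> adj y z -> z \in K.
  by move=> yK zR; apply/implyP; move/forall_inP: Kcl => /(_ y yK)/forall_inP; apply.
exists K => //; split=> //; split; first by exists x.
move=> A w wK wA Acl.
have big (B : {set G}) : B \subset K -> x \in B ->
    (forall y z, y \in B -> z \in K -> adj y z -> z \in B) -> B = K :> {set G}.
  move=> BK xB Bcl; apply/eqP; rewrite eqEcard BK /=; apply: Kmin.
  apply/and3P; split=> //; first exact: subset_trans KR.
  apply/forall_inP => y yB; apply/forall_inP => z zR; apply/implyP => yz.
  by apply: (Bcl y) => //; apply: (cl y) => //; apply: (subsetP BK).
have [xA|xA] := boolP (x \in A).
  suff <- : K :&: A = K by apply: subsetIr.
  apply: big; rewrite ?subsetIl ?inE ?xK // => y z /setIP[yK yA] zK yz.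
  by rewrite inE zK (Acl y).
have E : K :\: A = K.
  apply: big; rewrite ?subsetDl ?inE ?xA // => y z /setDP[yK yA] zK yz.
  rewrite inE zK andbT; apply: contra yA => zA; apply: (Acl z) => //.
  by rewrite adj_sym.
by move: wK; rewrite -E inE wA.
Qed.

Lemma sparseS R R' : R \subset R' -> sparse R' -> sparse R.
Proof.
move=> /subsetP RR' sp a b c d aR bR cR dR.
by apply: sp; apply: RR'.
Qed.

Lemma sparseU R1 R2 :
  (forall x y, x \in R1 -> y \in R2 -> ~~ adj x y) ->
  sparse R1 -> sparse R2 -> sparse (R1 :|: R2).
Proof.
move=> sep sp1 sp2.
have st1 x y : x \in R1 -> y \in R1 :|: R2 -> adj x y -> y \in R1.
  move=> x1 /setUP[//|y2] xy; by rewrite (negPf (sep _ _ x1 y2)) in xy.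
have st2 x y : x \in R2 -> y \in R1 :|: R2 -> adj x y -> y \in R2.
  move=> x2 /setUP[y1|//] xy; rewrite adj_sym in xy.
  by rewrite (negPf (sep _ _ y1 x2)) in xy.
move=> a b c d aR bR cR dR ac ab bc; case/setUP: (aR) => [a1|a2].
  have b1 := st1 _ _ a1 bR ab; have c1 := st1 _ _ b1 cR bc.
  split=> [ad|bd].
    by apply: (sp1 a b c d _ _ _ _ _ _ _).1 => //; apply: (st1 a).
  by apply: (sp1 a b c d _ _ _ _ _ _ _).2 => //; apply: (st1 b).
have b2 := st2 _ _ a2 bR ab; have c2 := st2 _ _ b2 cR bc.
split=> [ad|bd].
  by apply: (sp2 a b c d _ _ _ _ _ _ _).1 => //; apply: (st2 a).
by apply: (sp2 a b c d _ _ _ _ _ _ _).2 => //; apply: (st2 b).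
Qed.

(** Among at most three vertices, only a triangle has a third edge. *)
Lemma sparse3 R :
  #|R| <= 3 -> #|R| <= 2 \/ (exists2 x, x \in R & #|nbrs R x| <= 1) -> sparse R.
Proof.
move=> R3 hx a b c d aR bR cR dR ac ab bc.
have nab : a != b by apply: contraTneq ab => ->; rewrite adj_irr.
have nbc : b != c by apply: contraTneq bc => ->; rewrite adj_irr.
have in3 z : z \in R -> z = a \/ z = b \/ z = c.
  move=> zR; case: (eqVneq z a) => [|za]; first by left.
  case: (eqVneq z b) => [|zb]; first by right; left.
  case: (eqVneq z c) => [|zc]; first by right; right.
  have := @uniq_size_card G R [:: a; b; c; z]; rewrite /= !inE aR bR cR zR !negb_or.
  rewrite nab ac nbc (eq_sym a) za (eq_sym b) zb (eq_sym c) zc => /(_ isT isT).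
  by rewrite ltnNge R3.
split=> [ad|bd]; last first.
  have [|[dE|]] := in3 d dR; [by left| |by right].
  by rewrite dE adj_irr in bd.
have [dE|[//|dE]] := in3 d dR; first by rewrite dE adj_irr in ad.
have {dE}ac_adj : adj a c by rewrite -dE.
exfalso.
have two y z w : y \in R -> z \in R -> z != y -> adj w y -> adj w z -> 1 < #|nbrs R w|.
  move=> yR zR zy wy wz.
  apply: (@uniq_size_card G (nbrs R w) [:: z; y]); rewrite /= ?inE ?zy //.
  by rewrite yR zR wy wz.
case: hx => [R2|[x xR]].
  have := @uniq_size_card G R [:: a; b; c]; rewrite /= !inE aR bR cR !negb_or.
  by rewrite nab ac nbc => /(_ isT isT); rewrite ltnNge R2.
rewrite leqNgt => /negP[]; have [->|[->|->]] := in3 x xR.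
- by apply: (two b c) => //; rewrite eq_sym.
- by apply: (two a c) => //; [rewrite eq_sym|rewrite adj_sym].
- by apply: (two a b) => //; [rewrite eq_sym|rewrite adj_sym|rewrite adj_sym].
Qed.

Lemma conn_exit K A x :
  conn_set K -> x \in K -> x \in A -> ~~ (K \subset A) ->
  exists y z, [/\ y \in K, y \in A, z \in K, z \notin A & adj y z].
Proof.
move=> [_ Kc] xK xA /negP nKA; apply: contrapT => no; apply: nKA.
apply: (Kc A x) => // y z yK yA zK yz.
by apply: contra_notT no => zA; exists y, z.
Qed.

(** * Paths and cycles in sets of maximum degree two *)

(** As long as a path misses a vertex, connectivity provides an edge leaving
    it.  Inner vertices of the path have no neighbour left, so the edge leaves
    from an end and the path can be extended there. *)
Lemma path_grow S k :
  conn_set S -> (forall x, x \in S -> #|nbrs S x| <= 2) -> k < #|S| ->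
  exists x p, [/\ size p = k, path adj x p, uniq (x :: p) & all (mem S) (x :: p)].
Proof.
move=> cS d2; elim: k => [|k IH] kS.
  by case: (cS) => [[x xS] _]; exists x, [::]; rewrite /= xS.
have [x [p [sz pp up pS]]] := IH (ltnW kS).
pose A := [set z | z \in x :: p].
have : ~~ (S \subset A).
  apply: contraL kS => /subset_leq_card; rewrite cardsE.
  by move: up => /card_uniqP->; rewrite /= sz -leqNgt.
have xS : x \in S by move: pS => /=/andP[].
move=> /(conn_exit cS xS); rewrite inE mem_head => /(_ isT).
case=> y [z [yS]]; rewrite !inE => yA zS zA yz.
have zp : z \notin x :: p by rewrite inE.
case/predU1P: yA => [yx|yp].
  exists z, (x :: p); split; rewrite /= ?sz //.
  - by rewrite pp andbT adj_sym -yx.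
  - by move: up => /= ->; rewrite zp.
  - by move: pS => /= ->; rewrite zS.
have [yl|yl] := eqVneq y (last x p).
  exists x, (rcons p z); rewrite size_rcons sz rcons_path pp -yl yz -rcons_cons.
  rewrite rcons_uniq zp up all_rcons pS andbT.
  by split=> //; rewrite /= zS.
case/splitPr: yp pp up pS yl zp {sz zA A} => p1 [|t p2] pp up pS yl zp.
  by rewrite last_cat /= eqxx in yl.
move: pp; rewrite cat_path /= => /and4P[_ l1 yt _].
have := d2 y yS; rewrite leqNgt => /negP[].
have lS : last x p1 \in x :: p1 by apply: mem_last.
have tS : t \in S by move: pS; rewrite /= all_cat /= => /and5P[].
have lS' : last x p1 \in S.
  apply: (allP pS); rewrite -cat_cons mem_cat lS //.
have lt : last x p1 != t.
  apply: contraTneq up => E; rewrite -cat_cons cat_uniq.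
  apply/and3P=> -[_ /hasP[]]; exists t; last by rewrite /= -E.
  by rewrite !inE eqxx orbT.
have zl : last x p1 != z.
  by apply: contraNneq zp => <-; rewrite -cat_cons mem_cat lS.
have zt : t != z.
  by apply: contraNneq zp => <-; rewrite -cat_cons mem_cat !inE eqxx !orbT.
apply: (@uniq_size_card G _ [:: last x p1; t; z]); first by rewrite /= !inE negb_or lt zl zt.
by rewrite /= !inE lS' tS zS yt yz adj_sym l1.
Qed.

(** A path through all of [K] closes up: the second neighbour of its first
    vertex cannot be an inner vertex, which already has two other
    neighbours. *)
Lemma ham_cycle K y :
  conn_set K -> (forall x, x \in K -> #|nbrs K x| = 2) -> y \in K ->
  exists c, [/\ cycle adj (y :: c), uniq (y :: c) & K =i y :: c].
Proof.
move=> cK d2 yK; have K0 : #|K|.-1 < #|K| by rewrite prednK //; apply/card_gt0P; exists y.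
have [|x [p [sz pp up pK]]] := @path_grow K _ cK _ K0; first by move=> x /d2->.
have EK : x :: p =i K.
  have [] // := @uniq_min_size _ (x :: p) (enum K) up.
  - by move=> z /(allP pK); rewrite mem_enum.
  - by rewrite -cardE /= sz prednK //; case: #|K| K0.
  - by move=> _ E z; rewrite E mem_enum.
have xK : x \in K by rewrite -EK mem_head.
have cyc : adj (last x p) x.
  case: p => [|t p] in sz pp up pK EK *.
    have [z] := @card2_other G (nbrs K x) x (eq_leq (esym (d2 x xK))).
    by rewrite in_nbrs -EK inE => /andP[/eqP->]; rewrite eqxx.
  have [z] := @card2_other G (nbrs K x) t (eq_leq (esym (d2 x xK))).
  rewrite in_nbrs -EK => /andP[zK xz] zt.
  have [<-|zl] := eqVneq z (last x (t :: p)); first by rewrite adj_sym.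
  have zx : z != x by apply: contraTneq xz => ->; rewrite adj_irr.
  move: zK; rewrite !inE (negPf zx) (negPf zt) /= => zp.
  case/splitPr: zp pp up pK EK zl {sz} => p1 [|w p2].
    by rewrite /= last_cat /= eqxx.
  rewrite /= cat_path /= => /and5P[xt _ l1 zw _] up pK EK _.
  have zK : z \in K by rewrite -EK !(inE, mem_cat) eqxx !orbT.
  have wK : w \in K by rewrite -EK !(inE, mem_cat) eqxx !orbT.
  have lin : last t p1 \in t :: p1 by apply: mem_last.
  have lK : last t p1 \in K by rewrite -EK inE -cat_cons mem_cat lin orbT.
  have up' : uniq (x :: (t :: p1) ++ [:: z, w & p2]) by exact: up.
  move: up'; rewrite cons_uniq cat_uniq mem_cat negb_or.
  case/and4P=> /andP[xl xzw] _ nh _.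
  have := @uniq_size_card G (nbrs K z) [:: x; last t p1; w].
  rewrite (d2 _ zK) /= !in_nbrs xK lK wK (adj_sym z x) xz zw (adj_sym z) l1 !inE negb_or.
  have -> : x != last t p1 by apply: contraNneq xl => ->.
  have -> : x != w by apply: contraNneq xzw => ->; rewrite !inE eqxx orbT.
  have -> : last t p1 != w.
    apply/eqP => E; move/hasPn: nh => /(_ w).
    by rewrite !inE eqxx orbT -E => /(_ isT) /=; rewrite -in_cons lin.
  by move=> /(_ isT isT).
have yxp : y \in x :: p by rewrite EK.
have [c rc] : exists c, rot (index y (x :: p)) (x :: p) = y :: c.
  by eexists; apply: rot_index.
exists c; rewrite -rc; split.
- by rewrite rot_cycle /= rcons_path pp.
- by rewrite rot_uniq.
- by move=> z; rewrite mem_rot EK.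
Qed.

Lemma path_invariant A x p :
  path adj x p ->
  (forall u v, u \in x :: p -> v \in x :: p -> adj u v -> u \in A -> v \in A) ->
  forall u, u \in x :: p -> (u \in A) = (x \in A).
Proof.
elim: p x => [|t p IH] x /=; first by move=> _ _ u; rewrite inE => /eqP->.
case/andP=> xt tp cl.
have tx : (t \in A) = (x \in A).
  apply/idP/idP => [tA|xA].
    by apply: (cl t); rewrite ?inE ?eqxx ?orbT // adj_sym.
  by apply: (cl x); rewrite ?inE ?eqxx ?orbT.
move=> u; rewrite inE => /predU1P[->//|ut]; rewrite (IH t) // => v w vt wt.
by apply: cl; rewrite inE ?vt ?wt orbT.
Qed.

(** A cycle stays connected after deleting one vertex.  This replaces the
    analysis of positions on 7-cycles in most of what follows. *)
Lemma cycle_del_conn K y A a :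
  conn_set K -> (forall x, x \in K -> #|nbrs K x| = 2) -> y \in K ->
  a \in K -> a \in A -> a != y ->
  (forall u v, u \in K -> u != y -> u \in A -> v \in K -> v != y -> adj u v -> v \in A) ->
  forall u, u \in K -> u != y -> u \in A.
Proof.
move=> cK d2 yK aK aA ay cl u uK uy.
have [c [pc uc Ec]] := ham_cycle cK d2 yK.
have inc w : w \in K -> w != y -> w \in c.
  by rewrite Ec inE => /orP[->|].
have ofc w : w \in c -> w \in K /\ w != y.
  move=> wc; rewrite Ec inE wc orbT; split=> //.
  by apply: contraTneq uc => <-; rewrite /= wc.
case: c => [|x p] in pc uc Ec inc ofc; first by have := inc _ aK ay.
move: pc; rewrite /= rcons_path => /and3P[_ xp _].
have inv : forall w, w \in x :: p -> (w \in A) = (x \in A).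
  apply: path_invariant => // v w /ofc[vK vy] /ofc[wK wy] vw vA.
  exact: (cl v).
by rewrite inv ?inc // -(inv a) ?inc.
Qed.

(** * Isolating components separately *)

(** A partly dominated triangle leaves at most an edge.  A 7-cycle
    [y c1 .. c6] with [y] dominated leaves a path, and [c3] splits it into [c1]
    and the edge [c5 c6].  The gain of 3 over the general bound pays for most of
    one further dominator. *)
Lemma exceptional_touched K D0 y :
  exceptional K -> y \in K -> y \in closed_nbhd D0 ->
  exists2 D1 : {set G}, 4 * #|D1| + 3 <= #|K| &
    sparse (K :\: closed_nbhd (D0 :|: D1)).
Proof.
case=> K37 cK d2 yK yD.
have yN (D1 : {set G}) : y \in closed_nbhd (D0 :|: D1).
  by apply: (subsetP (nbhdS (subsetUl _ _))).
case: K37 => cardK.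
  exists set0; first by rewrite cards0 cardK.
  have le2 : #|K :\: closed_nbhd (D0 :|: set0)| <= 2.
    have /subset_leq_card : K :\: closed_nbhd (D0 :|: set0) \subset K :\ y.
      by apply: setDS; rewrite sub1set.
    by move/leq_trans; apply; rewrite -ltnS (leq_trans _ (eq_leq cardK)) // [#|K|](cardsD1 y) yK.
  by apply: sparse3; [lia|left].
have [c [pc uc Ec]] := ham_cycle cK d2 yK.
have : size c = 6.
  have := card_uniqP uc; rewrite -(eq_card Ec) cardK /= => -[].
  by [].
case: c pc uc Ec => [//|c1 [//|c2 [//|c3 [//|c4 [//|c5 [//|c6 [|//]]]]]]] pc uc Ec _.
move: pc => /=/and5P[yc1 c12 c23 c34 /and4P[c45 c56 c6y _]].
exists [set c3]; first by rewrite cards1 cardK.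
have c1K : c1 \in K by rewrite Ec !inE eqxx ?orbT.
have c2K : c2 \in K by rewrite Ec !inE eqxx ?orbT.
have n1 z : z \in K -> adj c1 z -> z = y \/ z = c2.
  move=> zK c1z; apply: (@card2_mem G (nbrs K c1)); rewrite ?d2 ?in_nbrs ?yK ?c2K ?zK //.
    by rewrite adj_sym.
  by apply: contraTneq uc => ->; rewrite /= !inE eqxx ?orbT.
apply: (@sparseS _ [set c1; c5; c6]).
  apply/subsetP => z; rewrite !in_setD Ec => /andP[zN].
  have c3N : c3 \in D0 :|: [set c3] by rewrite !inE eqxx orbT.
  have nz w : w \in closed_nbhd (D0 :|: [set c3]) -> (z == w) = false.
    by move=> wN; apply: contraNF zN => /eqP->.
  have c2N : c2 \in closed_nbhd (D0 :|: [set c3]).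
    by apply: (nbhd_adj c3N); rewrite adj_sym.
  rewrite !inE (nz y) // (nz _ c2N) (nz _ (nbhd_in c3N)) (nz _ (nbhd_adj c3N c34)).
  by rewrite !orFb orbA.
apply: sparse3.
  by apply: leq_trans (leq_card_setU _ _) _; rewrite cards1 cards2; case: (_ != _).
right; exists c1; first by rewrite !inE eqxx.
rewrite (_ : nbrs _ _ = set0) ?cards0 //; apply/setP => z; rewrite in_nbrs in_set0.
apply/negP => /andP[zR c1z].
have zc : z \in K by rewrite Ec; move: zR; rewrite !inE => /orP[/orP[]|] ->; rewrite ?orbT.
move: zR; case: (n1 z zc c1z) => ->; apply/negP; rewrite !inE;
by apply: contraTN uc => /orP[/orP[]|] /eqP ->; rewrite /= !inE eqxx ?orbT ?andbF.
Qed.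

(** The vertices of [K] have used up their neighbours, so no edge of [C] leaves
    [K]. *)
Lemma exceptional_maximal K (C : {set G}) :
  exceptional K -> K \subset C -> conn_set C ->
  (forall x, x \in K -> #|nbrs C x| <= 2) -> K = C.
Proof.
case=> _ [[x xK] _] d2 KC [_ cC] dC; apply/eqP; rewrite eqEsubset KC /=.
apply: (cC K x) => // [|y z yC yK zC yz]; first exact: (subsetP KC).
suff /eqP E : nbrs K y == nbrs C y.
  have : z \in nbrs K y by rewrite E in_nbrs zC.
  by rewrite in_nbrs => /andP[].
rewrite eqEcard (d2 y yK) dC // andbT; apply/subsetP => w.
by rewrite !in_nbrs => /andP[/(subsetP KC)-> ->].
Qed.

(** A single vertex pays for any four vertices it dominates. *)
Lemma isolable_extend S X D u :
  X \subset S -> (forall w, w \in X -> w = u \/ adj u w) -> 4 * #|D| + 4 <= #|S| ->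
  sparse ((S :\: X) :\: closed_nbhd ([set u] :|: D)) -> isolable S.
Proof.
move=> XS Xu DS sp; exists ([set u] :|: D).
  by have := (leq_card_setU [set u] D).1; rewrite cards1; lia.
apply: sparseS sp; apply/subsetP => w /setDP[wS wN]; rewrite !in_setD wN wS andbT /=.
apply: contra wN => /Xu wu; apply: (subsetP (nbhdS (subsetUl _ _))).
by rewrite nbhd1E; case: wu => ->; rewrite ?eqxx ?orbT.
Qed.

(** Components have no edges between them, so isolating sets can be united.
    The set [D0] stands for dominators already chosen, which make exceptional
    components affordable. *)
Lemma isolate_components R D0 :
  (forall K, component R K ->
     isolable K \/ exceptional K /\ exists2 y, y \in K & y \in closed_nbhd D0) ->
  exists2 D : {set G}, 4 * #|D| <= #|R| & sparse (R :\: closed_nbhd (D0 :|: D)).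
Proof.
elim: {R}_.+1 {-2}R (ltnSn #|R|) => // n IH R Rn HR.
have [->|[x xR]] := set_0Vmem R.
  by exists set0; rewrite ?cards0 // set0D => a b c d; rewrite inE.
have [K cK xK] := component_ex xR.
have [KR _ Kcl] := cK.
have [D1 D1K sp1] : exists2 D : {set G}, 4 * #|D| <= #|K| &
    sparse (K :\: closed_nbhd (D0 :|: D)).
  case: (HR K cK) => [[D DK sp]|[eK [y yK yD]]].
    exists D => //; apply: sparseS sp; apply: setDS; apply: nbhdS; exact: subsetUr.
  have [D DK sp] := exceptional_touched eK yK yD; exists D => //; lia.
have cardR : #|R| = #|K| + #|R :\: K| by rewrite cardsD (setIidPr KR) subnKC // subset_leq_card.
have K0 : 0 < #|K| by apply/card_gt0P; exists x.
have [||D2 D2K sp2] := IH (R :\: K); first lia.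
  move=> L [LR cL Lcl]; apply: HR; split=> //.
    exact: subset_trans LR (subsetDl _ _).
  move=> y z yL zR yz; apply: (Lcl y) => //; rewrite inE zR andbT.
  apply/negP => zK; have /setDP[yR /negP[]] := subsetP LR _ yL.
  by apply: (Kcl z) => //; rewrite adj_sym.
exists (D1 :|: D2); first by have := (leq_card_setU D1 D2).1; lia.
rewrite -(setID R K) setDUl (setIidPr KR); apply: sparseU.
- move=> y z /setDP[yK _] /setDP[/setDP[zR zK] _]; apply: contra zK; exact: Kcl.
- by apply: sparseS sp1; apply: setDS; apply: nbhdS; apply: setUS; apply: subsetUl.
- by apply: sparseS sp2; apply: setDS; apply: nbhdS; apply: setUS; apply: subsetUr.
Qed.

End Sets.

(** * Minimal counterexamples *)

Section Minimal.
Variables (G : sgraph) (S : {set G}).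
Hypothesis conS : conn_set S.
Hypothesis IH : forall R : {set G}, #|R| < #|S| -> conn_set R -> ~ exceptional R -> isolable R.
Hypothesis nS : ~ isolable S.
Implicit Types (x y z u v w : G) (A D K R X : {set G}).

Definition ball v : {set G} := v |: nbrs S v.

Lemma in_ball v w : (w \in ball v) = (w == v) || (w \in S) && adj v w.
Proof. by rewrite !inE. Qed.

Lemma ball_sub v : v \in S -> ball v \subset S.
Proof. by move=> vS; apply/subsetP => w; rewrite in_ball => /predU1P[->|/andP[]]. Qed.

(** If every exceptional component of [S - X] had a vertex dominated by [u], all
    components could be isolated within a quarter of their size, and [u] would
    be paid for by the four vertices of [X]. *)
Lemma removal u X :
  X \subset S -> 3 < #|X| -> (forall w, w \in X -> w = u \/ adj u w) ->
  exists A, [/\ component (S :\: X) A, exceptional A &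
                forall w, w \in A -> w != u /\ ~~ adj u w].
Proof.
move=> XS X4 Xu; apply: contrapT => no.
have cardS : #|S| = #|X| + #|S :\: X| by rewrite cardsD (setIidPr XS) subnKC // subset_leq_card.
have [|D DX sp] := @isolate_components G (S :\: X) [set u].
  move=> K cK; have [eK|neK] := pselect (exceptional K); last first.
    left; case: cK => KR cK _; apply: IH => //.
    by have := subset_leq_card KR; lia.
  right; split=> //; apply: contrapT => nt; apply: no; exists K; split=> // w wK.
  apply/andP; rewrite -negb_or -nbhd1E; apply/negP => wN; apply: nt; by exists w.
by apply: nS; apply: (isolable_extend XS Xu _ sp); lia.
Qed.

(** Every component of [S - x] contains a neighbour of [x], so taking [x] as a
    dominator touches all of them.  The vertex [x] and the gain of 3 on [K]
    together pay for it. *)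
Lemma no_exceptional_branch x K :
  x \in S -> component (S :\ x) K -> exceptional K -> False.
Proof.
move=> xS [KS cK Kcl] eK.
have touch (L : {set G}) : L \subset S :\ x -> conn_set L ->
    (forall y z, y \in L -> z \in S -> z != x -> adj y z -> z \in L) ->
    exists2 y, y \in L & y \in closed_nbhd [set x].
  move=> LS [[l lL] _] Lcl.
  have lS : l \in S by move/subsetP: LS => /(_ l lL) /setD1P[].
  have [|y [z [yS yL zS zL yz]]] := conn_exit conS lS lL.
    by apply/negP => /subsetP/(_ x xS) /(subsetP LS); rewrite !inE eqxx.
  exists y => //; rewrite nbhd1E adj_sym; apply/orP; right.
  suff -> : x = z by [].
  by apply/eqP; rewrite eq_sym; apply: contraNT zL => zx; apply: (Lcl y).
have Kcl' y z : y \in K -> z \in S -> z != x -> adj y z -> z \in K.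
  by move=> yK zS zx; apply: Kcl; rewrite // !inE zx.
have [y yK yN] := touch K KS cK Kcl'.
have [D1 D1K sp1] := exceptional_touched eK yK yN.
pose R := S :\ x :\: K.
have cardS : #|S| = 1 + (#|K| + #|R|).
  rewrite (cardsD1 x) xS; congr (_ + _).
  by rewrite /R [#|_ :\: K|]cardsD (setIidPr KS) subnKC // subset_leq_card.
have RK z w : z \in R -> w \in K -> ~~ adj z w.
  case/setDP=> zS zK wK; apply: contra zK => zw; apply: (Kcl w) => //.
  by rewrite adj_sym.
have [|D2 D2R sp2] := @isolate_components G R [set x].
  move=> L [LR cL Lcl]; have [eL|neL] := pselect (exceptional L); last first.
    left; apply: IH => //; have := subset_leq_card LR; lia.
  right; split=> //; apply: touch => //; first exact: subset_trans LR (subsetDl _ _).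
  move=> z w zL wS wx zw; apply: (Lcl z) => //; rewrite !inE wx wS !andbT.
  by apply: contraTN zw; apply: RK; apply: (subsetP LR).
apply: nS; exists ([set x] :|: (D1 :|: D2)).
  have := (leq_card_setU [set x] (D1 :|: D2)).1.
  by have := (leq_card_setU D1 D2).1; rewrite cards1; lia.
apply: (@sparseS _ _ ((K :\: closed_nbhd ([set x] :|: (D1 :|: D2))) :|:
  (R :\: closed_nbhd ([set x] :|: (D1 :|: D2))))).
  apply/subsetP => z /setDP[zS zN].
  have zx : z != x by apply: contraNneq zN => ->; rewrite nbhd_in // !inE eqxx.
  by rewrite in_setU !in_setD zN zS in_set1 zx !andbT orbN.
apply: sparseU.
- by move=> z w /setDP[zK _] /setDP[wR _]; rewrite adj_sym; apply: RK.
- by apply: sparseS sp1; apply: setDS; apply: nbhdS; apply: setUS; apply: subsetUl.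
- by apply: sparseS sp2; apply: setDS; apply: nbhdS; apply: setUS; apply: subsetUr.
Qed.

Lemma exceptional_beyond v :
  v \in S -> 2 < #|nbrs S v| ->
  exists2 H : {set G}, component (S :\: ball v) H & exceptional H.
Proof.
move=> vS d3; have [|||H [cH eH _]] := @removal v (ball v).
- exact: ball_sub.
- by rewrite cardsU1 in_nbrs adj_irr andbF.
- by move=> w; rewrite in_ball => /orP[/eqP|/andP[_]]; [left|right].
by exists H.
Qed.

Section Outside.
Variables (v : G) (H : {set G}).
Hypotheses (vS : v \in S) (cH : component (S :\: ball v) H).

Lemma center_notin : v \notin H.
Proof.
have [HS _ _] := cH; apply/negP => /(subsetP HS).
by rewrite inE in_ball eqxx.
Qed.

Lemma nbr_notin x : x \in nbrs S v -> x \notin H.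
Proof.
have [HS _ _] := cH => xv; apply/negP => /(subsetP HS).
by rewrite inE in_setU xv orbT.
Qed.

Lemma nbr_neq x : x \in nbrs S v -> x != v.
Proof. by rewrite in_nbrs => /andP[_]; apply: contraTneq => ->; rewrite adj_irr. Qed.

Lemma component_inS y : y \in H -> y \in S.
Proof. by have [HS _ _] := cH => /(subsetP HS) /setDP[]. Qed.

Lemma nbrsS x : x \in nbrs S v -> x \in S.
Proof. by rewrite in_nbrs => /andP[]. Qed.

(** Since [H] is a component outside the closed neighbourhood of [v], edges
    leaving it end in neighbours of [v]. *)
Lemma component_exit y z : y \in H -> z \in S -> adj y z -> z \in H \/ z \in nbrs S v.
Proof.
have [HS _ Hcl] := cH => yH zS yz.
have [zv|zv] := boolP (z \in nbrs S v); [by right|left].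
apply: (Hcl y) => //; rewrite inE zS andbT in_setU1 negb_or zv andbT.
have yS := component_inS yH; apply: contraTneq yH => zE; apply: nbr_notin.
by rewrite in_nbrs yS -zE adj_sym.
Qed.

(** Otherwise [x] would separate [H] from the rest, making [H] an exceptional
    component of [S - x]. *)
Lemma two_links x : exceptional H -> x \in nbrs S v ->
  exists x' y, [/\ x' \in nbrs S v, x' != x, y \in H & adj x' y].
Proof.
have [HS cnH Hcl] := cH => eH xv; apply: contrapT => no.
apply: (@no_exceptional_branch x H) => //; first exact: nbrsS.
split=> //.
  apply/subsetP => y yH; rewrite !inE component_inS // andbT.
  by apply: contraTneq yH => ->; apply: nbr_notin.
move=> y z yH /setD1P[zx zS] yz.
have [//|zv] := component_exit yH zS yz; case: no; exists z, y.
by rewrite zv zx yH adj_sym.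
Qed.

End Outside.

(** * Pieces around a branching vertex *)

Section Center.
Variables (v : G) (H : {set G}).
Hypotheses (vS : v \in S) (v3 : 2 < #|nbrs S v|).
Hypotheses (cH : component (S :\: ball v) H) (eH : exceptional H).

Local Notation nbr_notinH := (nbr_notin cH).
Local Notation HS := (component_inS cH).

(** The vertex [y] with three of its neighbours: four vertices dominated by
    [y].  When [H] is a triangle this is [H] together with [x]. *)
Definition claw x y : {set G} := x |: (y |: nbrs H y).

(** The obstruction that [removal] produces for the claw at [(x, y)]. *)
Definition piece x y A : Prop :=
  [/\ component (S :\: claw x y) A, exceptional A, v \in A &
      forall w, w \in A -> w != y /\ ~~ adj y w].

Lemma in_claw x y z : (z \in claw x y) = [|| z == x, z == y | (z \in H) && adj y z].
Proof. by rewrite !inE. Qed.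

Lemma claw_sub x y z : y \in H -> z \in claw x y -> z = x \/ z \in H.
Proof.
by move=> yH; rewrite in_claw => /or3P[/eqP->|/eqP->|/andP[? _]]; [left|right|right].
Qed.

(** If the undominated exceptional component [A] missed [v], it would miss all
    neighbours of [v]: [x] is removed, and each other neighbour is adjacent to
    [v], which survives.  Then [A] is either inside [H], hence all of [H] although [y] is
    removed, or a component outside the closed neighbourhood of [v].  In the
    latter case [two_links] joins it to a neighbour of [v] other than [x], which
    survives. *)
Lemma piece_ex x y : x \in nbrs S v -> y \in H -> adj x y -> exists A, piece x y A.
Proof.
have [_ cnH Hcl] := cH; have [_ _ d2] := eH => xv yH xy.
have xS := nbrsS xv; have xH := nbr_notinH xv.
have [|||A [cA eA Ay]] := @removal y (claw x y).
- apply/subsetP => z /(claw_sub yH)[->//|]; exact: HS.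
- rewrite cardsU1 cardsU1 d2 // !inE negb_or adj_irr andbF (negPf xH) andbT.
  by have -> : x != y by apply: contraNneq xH => ->.
- move=> w; rewrite in_claw => /or3P[/eqP->|/eqP->|/andP[_ yw]]; [right|by left|by right].
  by rewrite adj_sym.
exists A; split=> //; apply: contrapT => vA.
have [AS cnA Acl] := cA.
have inS z : z \in S -> z != x -> z \notin H -> z \in S :\: claw x y.
  move=> zS zx zH; rewrite inE zS andbT; apply/negP => /(claw_sub yH)[zE|].
    by rewrite zE eqxx in zx.
  by rewrite (negPf zH).
have vin : v \in S :\: claw x y.
  by apply: inS => //; [rewrite eq_sym (nbr_neq xv)|exact: center_notin cH].
have Av a : a \in A -> a \notin nbrs S v.
  move=> aA; apply/negP; rewrite in_nbrs => /andP[_ va]; apply: vA.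
  by apply: (Acl a) => //; rewrite adj_sym.
have Aball a : a \in A -> a \in S :\: ball v.
  move=> aA; have /setDP[aS _] := subsetP AS _ aA.
  rewrite inE aS andbT in_setU1 negb_or Av // andbT.
  by apply: contra_notN vA => /eqP <-.
have [[a /andP[aA aH]]|nAH] := pselect (exists a, (a \in A) && (a \in H)).
  have AH : A \subset H.
    case: cnA => _ cn; apply: (cn H a) => // s t sA sH tA st.
    by apply: (Hcl s) => //; apply: Aball.
  have E : A = H by apply: exceptional_maximal => // z zA; rewrite d2 // (subsetP AH).
  have [] := Ay y; first by rewrite E.
  by rewrite eqxx.
have AH a : a \in A -> a \notin H.
  by move=> aA; apply/negP => aH; apply: nAH; exists a; rewrite aA.
have cA' : component (S :\: ball v) A.
  split=> //; first by apply/subsetP.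
  move=> a z aA /setDP[zS zN] az; apply: (Acl a) => //; apply: inS => //.
    by apply: contraNneq zN => ->; rewrite in_setU1 xv orbT.
  apply: contra (AH a aA) => zH; apply: (Hcl z) => //; first exact: Aball.
  by rewrite adj_sym.
have [z [a [zv zx aA za]]] := two_links cA' eA xv.
apply: (negP (Av z _)) => //; apply: (Acl a) => //; last by rewrite adj_sym.
by apply: inS; rewrite ?(nbrsS zv) // nbr_notinH.
Qed.

Lemma piece_nbr x y A z : x \in nbrs S v -> y \in H -> piece x y A ->
  z \in nbrs S v -> z != x -> z \in A.
Proof.
move=> xv yH [[_ _ Acl] _ vA _] zv zx; apply: (Acl v) => //; last first.
  by move: zv; rewrite in_nbrs => /andP[].
rewrite inE (nbrsS zv) andbT; apply/negP => /(claw_sub yH)[zE|].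
  by rewrite zE eqxx in zx.
by rewrite (negPf (nbr_notinH zv)).
Qed.

(** The other neighbours of [v] all lie in a piece, where [v] has degree
    two. *)
Lemma degree3 : #|nbrs S v| = 3.
Proof.
have [x xv] : exists x, x \in nbrs S v by apply/card_gt0P; lia.
have [x' [y [x'v _ yH x'y]]] := two_links cH eH xv.
have [A pA] := piece_ex x'v yH x'y; have [_ [_ _ d2] vA _] := pA.
have : nbrs S v :\ x' \subset nbrs A v.
  apply/subsetP => z /setD1P[zx zv]; rewrite in_nbrs (piece_nbr x'v yH pA) //.
  by move: zv; rewrite in_nbrs => /andP[].
by move/subset_leq_card; rewrite d2 //; move: v3; rewrite (cardsD1 x') x'v; lia.
Qed.

End Center.

Lemma degree_le3 x : x \in S -> #|nbrs S x| <= 3.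
Proof.
move=> xS; rewrite leqNgt; apply/negP => x4.
have [H cH eH] := exceptional_beyond xS (ltnW x4).
by have := degree3 xS (ltnW x4) cH eH; lia.
Qed.

(** * Excluding vertices of degree three *)

Section Claws.
Variables (v : G) (H : {set G}).
Hypotheses (vS : v \in S) (v3 : 2 < #|nbrs S v|).
Hypotheses (cH : component (S :\: ball v) H) (eH : exceptional H).

Local Notation nbr_notinH := (nbr_notin cH).
Local Notation HS := (component_inS cH).
Local Notation claw := (claw H).
Local Notation piece := (piece v H).

Lemma cycle_nbrs2 y : y \in H -> #|nbrs H y| = 2.
Proof. by case: eH => _ _; apply. Qed.

(** An edge leaving the piece ends in the claw, but not at [y], which dominates
    no vertex of the piece. *)
Lemma piece_exit x y A w z :
  y \in H -> piece x y A -> w \in A -> z \in S -> adj w z ->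
  [\/ z \in A, z = x | (z \in H) && adj y z].
Proof.
move=> yH [[_ _ Acl] _ _ Ay] wA zS wz.
have [|zX] := boolP (z \in claw x y); last first.
  by constructor 1; apply: (Acl w); rewrite // inE zX.
rewrite in_claw => /or3P[/eqP->|/eqP zy|zy]; [by constructor 2| |by constructor 3].
by have [_] := Ay w wA; rewrite -zy adj_sym wz.
Qed.

Lemma piece_sub x y A w : piece x y A -> w \in A -> w \in S /\ w \notin claw x y.
Proof. by move=> [[AS _ _] _ _ _] /(subsetP AS)/setDP[]. Qed.

Lemma piece_nbrs2 x y A w : piece x y A -> w \in A -> #|nbrs A w| = 2.
Proof. by move=> [_ [_ _ d2] _ _]; apply: d2. Qed.

Lemma in_nbrs_adj w : w \in nbrs S v -> adj v w.
Proof. by rewrite in_nbrs => /andP[]. Qed.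

Lemma outside_unique y x z :
  y \in H -> x \notin H -> z \notin H -> x \in S -> z \in S ->
  adj y x -> adj y z -> x = z.
Proof.
move=> yH xH zH xS zS yx yz; apply: contrapT => /eqP xz.
have := degree_le3 (HS yH).
have : [set x; z] :|: nbrs H y \subset nbrs S y.
  apply/subsetP => w; rewrite !inE => /orP[/orP[]/eqP->|/andP[wH ->]].
  - by rewrite xS.
  - by rewrite zS.
  - by rewrite HS.
move/subset_leq_card; rewrite cardsU cards2 xz cycle_nbrs2 // (_ : _ :&: _ = set0).
  by rewrite cards0; clear; lia.
apply/setP => w; rewrite !inE; apply/negP => /andP[/orP[]/eqP->].
  by rewrite (negPf xH).
by rewrite (negPf zH).
Qed.

(** A closed subset of a connected set is everything, and a piece has 3 or 7
    vertices. *)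
Lemma piece_closed x y A (s : seq G) :
  piece x y A -> v \in s -> uniq s -> 3 < size s -> all (mem A) s ->
  (forall u w, u \in s -> w \in A -> adj u w -> w \in s) -> 6 < size s.
Proof.
move=> pA vs us s4 sA cl; have [_ [A37 [_ cn] _] vA _] := pA.
have sub : A \subset [set z in s].
  apply: (cn _ v) => //; first by rewrite inE.
  by move=> u w uA; rewrite inE => us' wA uw; rewrite inE; apply: cl uw.
have := subset_leq_card sub; rewrite cardsE (card_uniqP us).
have := uniq_size_card us sA; case: A37 => ->; move: s4; lia.
Qed.

Lemma piece_nbrs_only x y A u a b w :
  piece x y A -> u \in A -> a \in A -> b \in A -> a != b ->
  adj u a -> adj u b -> w \in A -> adj u w -> w = a \/ w = b.
Proof.
move=> pA uA aA bA ab ua ub wA uw; apply: (@card2_mem G (nbrs A u)) => //.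
- by rewrite (piece_nbrs2 pA).
- by rewrite in_nbrs aA.
- by rewrite in_nbrs bA.
- by rewrite in_nbrs wA.
Qed.

Lemma nbrs_three x1 x2 x3 z :
  x1 \in nbrs S v -> x2 \in nbrs S v -> x3 \in nbrs S v ->
  x1 != x2 -> x1 != x3 -> x2 != x3 -> z \in nbrs S v -> [\/ z = x1, z = x2 | z = x3].
Proof.
move=> v1 v2 v3' n12 n13 n23 zv; apply: contrapT => no.
have z1 : z != x1 by apply/eqP => E; apply: no; constructor 1.
have z2 : z != x2 by apply/eqP => E; apply: no; constructor 2.
have z3 : z != x3 by apply/eqP => E; apply: no; constructor 3.
have us : uniq [:: z; x1; x2; x3] by rewrite /= !inE !negb_or z1 z2 z3 n12 n13 n23.
have /= := @uniq_size_card G (nbrs S v) _ us; rewrite zv v1 v2 v3' => /(_ isT).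
by rewrite ltnNge (degree_le3 vS).
Qed.

Lemma other_nbrs x1 : x1 \in nbrs S v ->
  exists x2 x3, [/\ x2 \in nbrs S v, x3 \in nbrs S v, x1 != x2, x1 != x3 & x2 != x3].
Proof.
move=> v1; have : 1 < #|nbrs S v :\ x1| by move: v3; rewrite (cardsD1 x1) v1.
case/card_gt1P=> x2 [x3 [/setD1P[n2 v2] /setD1P[n3 v3'] n23]].
by exists x2, x3; split=> //; rewrite eq_sym.
Qed.

Lemma piece_x1 x1 y1 A1 : piece x1 y1 A1 -> x1 \notin A1.
Proof. by move=> p1; apply/negP => /(piece_sub p1)[_]; rewrite in_claw eqxx. Qed.

(** Deleting [x3] from the cycle [A1] leaves it connected, so some edge joins
    the part in [H] to the part outside, where [v] is.  Its outer end is a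
    neighbour of [v] other than [x1] and [x3]. *)
Lemma piece_enter x1 x2 x3 y1 A1 a :
  x1 \in nbrs S v -> x2 \in nbrs S v -> x3 \in nbrs S v ->
  x1 != x2 -> x1 != x3 -> x2 != x3 -> y1 \in H -> piece x1 y1 A1 ->
  a \in A1 -> a \in H -> exists y, [/\ y \in H, y \in A1 & adj x2 y].
Proof.
move=> v1 v2 v3' n12 n13 n23 y1H p1 aA aH; apply: contrapT => no.
have [_ [_ cA d2] vA _] := p1.
have x3A : x3 \in A1 by apply: (piece_nbr cH v1 y1H p1) => //; rewrite eq_sym.
have n3H := nbr_notinH v3'.
have vH : v \in H; last by rewrite (negPf (center_notin cH)) in vH.
apply: (@cycle_del_conn G A1 x3 H a cA d2 x3A aA aH) => //.
- by apply: contraNneq n3H => <-.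
- move=> u w uA u3 uH wA w3 uw; have [wS _] := piece_sub p1 wA.
  have [//|wv] := component_exit cH uH wS uw.
  have w1 : w != x1 by apply: contraTneq wA => ->; apply: piece_x1 p1.
  case: (nbrs_three v1 v2 v3' n12 n13 n23 wv) => E.
  - by rewrite E eqxx in w1.
  - by case: no; exists u; rewrite adj_sym -E.
  - by rewrite E eqxx in w3.
- by rewrite eq_sym (nbr_neq v3').
Qed.

(** Suppose the piece at [(x1, y1)] meets [H].  By [piece_enter] it contains a
    cycle through [y2 x2 v x3 y3] with [y2] and [y3] on [H].  The two vertices
    are not adjacent, since the cycle would then have length five.  So [y3]
    belongs to the piece at [(x2, y2)], where it has degree two with [x3] as a
    neighbour; one of its neighbours [h] on [H] must be in the claw at
    [(x2, y2)] and is thus adjacent to [y2] as well.  If [h] is in the first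
    piece, there is a cycle of length six; if not, [h] is adjacent to [y1], and
    has three neighbours on [H]. *)
Lemma piece_disjoint x1 y1 A1 a :
  x1 \in nbrs S v -> y1 \in H -> piece x1 y1 A1 -> a \in A1 -> a \notin H.
Proof.
move=> v1 y1H p1 aA; apply/negP => aH.
have [x2 [x3 [v2 v3' n12 n13 n23]]] := other_nbrs v1.
have [y2 [y2H y2A e2]] := piece_enter v1 v2 v3' n12 n13 n23 y1H p1 aA aH.
have n32 : x3 != x2 by rewrite eq_sym.
have [y3 [y3H y3A e3]] := piece_enter v1 v3' v2 n13 n12 n32 y1H p1 aA aH.
have x2A : x2 \in A1 by apply: (piece_nbr cH v1 y1H p1) => //; rewrite eq_sym.
have x3A : x3 \in A1 by apply: (piece_nbr cH v1 y1H p1) => //; rewrite eq_sym.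
have vA : v \in A1 by case: p1.
have x2H := nbr_notinH v2; have x3H := nbr_notinH v3'; have vH := center_notin cH.
have x2S := nbrsS v2; have x3S := nbrsS v3'.
have neqH x y : x \notin H -> y \in H -> x != y by move=> xH yH; apply: contraNneq xH => ->.
have n2v : x2 != v := nbr_neq v2.
have n3v : x3 != v := nbr_neq v3'.
have e2' : adj y2 x2 by rewrite adj_sym.
have e3' : adj y3 x3 by rewrite adj_sym.
have ny : y2 != y3.
  apply: contra_neq n23 => E.
  by apply: (outside_unique y2H) => //; rewrite E.
have av2 : adj x2 v by rewrite adj_sym in_nbrs_adj.
have av3 : adj x3 v by rewrite adj_sym in_nbrs_adj.
(* degrees in the piece are two, so these are all the neighbours there *)
have only := piece_nbrs_only p1.
have Nv w : w \in A1 -> adj v w -> w = x2 \/ w = x3.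
  by apply: only => //; apply: in_nbrs_adj.
have N2 w : w \in A1 -> adj x2 w -> w = v \/ w = y2.
  by apply: only => //; apply: neqH.
have N3 w : w \in A1 -> adj x3 w -> w = v \/ w = y3.
  by apply: only => //; apply: neqH.
have n2y3 : ~~ adj y2 y3.
  apply/negP => y23.
  have := @piece_closed x1 y1 A1 [:: v; x2; y2; y3; x3] p1.
  have -> : uniq [:: v; x2; y2; y3; x3].
    rewrite /= !inE !negb_or; repeat (apply/andP; split) => //;
    by [exact: neqH | rewrite eq_sym // neqH].
  rewrite /= vA x2A x3A y2A y3A !inE eqxx => /(_ isT isT isT isT) big.
  suff: false by []; apply: big.
  move=> u w; rewrite !inE => /or4P[/eqP->|/eqP->|/eqP->|/pred2P[->|->]] wA uw.
  - by case: (Nv w wA uw) => ->; rewrite eqxx ?orbT.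
  - by case: (N2 w wA uw) => ->; rewrite eqxx ?orbT.
  - have [|->|->] := only y2 x2 y3 w y2A x2A y3A _ e2' y23 wA uw; rewrite ?eqxx ?orbT //.
    exact: neqH.
  - rewrite adj_sym in y23.
    have [|->|->] := only y3 x3 y2 w y3A x3A y2A _ e3' y23 wA uw; rewrite ?eqxx ?orbT //.
    exact: neqH.
  - by case: (N3 w wA uw) => ->; rewrite eqxx ?orbT.
have [A2 p2] := piece_ex vS cH eH v2 y2H e2.
have x3A2 := piece_nbr cH v2 y2H p2 v3' n32.
have y3A2 : y3 \in A2.
  have [//|E|/andP[_]] := piece_exit y2H p2 x3A2 (HS y3H) e3.
    by rewrite -E y3H in x2H.
  by rewrite (negPf n2y3).
(* otherwise both neighbours of [y3] on [H] would be in [A2], besides [x3] *)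
have [h hH [h3 h2]] : exists2 h, h \in H & adj y3 h /\ adj y2 h.
  apply: contrapT => no.
  have : x3 |: nbrs H y3 \subset nbrs A2 y3.
    apply/subsetP => w /setU1P[->|]; first by rewrite in_nbrs x3A2.
    rewrite !in_nbrs => /andP[wH y3w]; rewrite y3w andbT.
    have [//|E|/andP[_ y2w]] := piece_exit y2H p2 y3A2 (HS wH) y3w.
      by rewrite -E wH in x2H.
    by case: no; exists w.
  move/subset_leq_card; rewrite (piece_nbrs2 p2) // cardsU1 cycle_nbrs2 //.
  by rewrite in_nbrs (negPf x3H).
rewrite adj_sym in h2; rewrite adj_sym in h3.
have h2' : adj y2 h by rewrite adj_sym.
have h3' : adj y3 h by rewrite adj_sym.
have nh2 : h != y2 by apply: contraTneq h2 => ->; rewrite adj_irr.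
have nh3 : h != y3 by apply: contraTneq h3 => ->; rewrite adj_irr.
have [hA|hE|/andP[_ yh]] := piece_exit y1H p1 y2A (HS hH) h2'.
- have := @piece_closed x1 y1 A1 [:: v; x2; y2; h; y3; x3] p1.
  have -> : uniq [:: v; x2; y2; h; y3; x3].
    rewrite /= !inE !negb_or; repeat (apply/andP; split) => //;
    by [exact: neqH | rewrite eq_sym // neqH].
  rewrite /= vA x2A x3A y2A y3A hA !inE eqxx => /(_ isT isT isT isT) big.
  suff: false by []; apply: big.
  move=> u w; rewrite !inE.
  move=> /or4P[/eqP->|/eqP->|/eqP->|/or3P[/eqP->|/eqP->|/eqP->]] wA uw.
  - by case: (Nv w wA uw) => ->; rewrite eqxx ?orbT.
  - by case: (N2 w wA uw) => ->; rewrite eqxx ?orbT.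
  - have [|->|->] := only y2 x2 h w y2A x2A hA _ e2' h2' wA uw; rewrite ?eqxx ?orbT //.
    exact: neqH.
  - have [->|->] := only h y2 y3 w hA y2A y3A ny h2 h3 wA uw; rewrite ?eqxx ?orbT //.
  - have [|->|->] := only y3 x3 h w y3A x3A hA _ e3' h3' wA uw; rewrite ?eqxx ?orbT //.
    exact: neqH.
  - by case: (N3 w wA uw) => ->; rewrite eqxx ?orbT.
- by have := nbr_notinH v1; rewrite -hE hH.
have y1A : y1 \notin A1 by apply/negP => /(piece_sub p1)[_]; rewrite in_claw eqxx orbT.
have := @uniq_size_card G (nbrs H h) [:: y1; y2; y3].
rewrite cycle_nbrs2 //= !in_nbrs y1H y2H y3H (adj_sym h y1) yh h2 h3 !inE negb_or ny.
have -> : y1 != y2 by apply: contraNneq y1A => ->.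
have -> : y1 != y3 by apply: contraNneq y1A => ->.
by move=> /(_ isT isT).
Qed.

(** In the piece at [(x1, y1)] the vertex [x] has two neighbours, none of them
    in [H], and its degree is at most three. *)
Lemma single_link_other x1 y1 A1 x h h' :
  x1 \in nbrs S v -> y1 \in H -> piece x1 y1 A1 ->
  x \in nbrs S v -> x != x1 -> h \in H -> h' \in H -> adj x h -> adj x h' -> h = h'.
Proof.
move=> v1 y1H p1 xv n1 hH h'H xh xh'; apply: contrapT => /eqP nh.
have xA := piece_nbr cH v1 y1H p1 xv n1.
have := degree_le3 (nbrsS xv).
have : [set h; h'] :|: nbrs A1 x \subset nbrs S x.
  apply/subsetP => w; rewrite !inE => /orP[/orP[]/eqP->|/andP[/(piece_sub p1)[wS _] ->]].
  - by rewrite HS.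
  - by rewrite HS.
  - by rewrite wS.
move/subset_leq_card; rewrite cardsU cards2 nh (piece_nbrs2 p1) // (_ : _ :&: _ = set0).
  by rewrite cards0; clear; lia.
have dis := piece_disjoint v1 y1H p1.
apply/setP => w; rewrite !inE; apply/negP => /andP[/orP[]/eqP-> /andP[/dis/negP[]]] //.
Qed.

Lemma single_link x h h' :
  x \in nbrs S v -> h \in H -> h' \in H -> adj x h -> adj x h' -> h = h'.
Proof.
move=> xv; have [x' [y' [v' nx y'H e']]] := two_links cH eH xv.
have [A p] := piece_ex vS cH eH v' y'H e'.
by apply: (single_link_other v' y'H p xv); rewrite eq_sym.
Qed.

(** Two neighbours in the piece at another link, and [y]. *)
Lemma linked_degree x y : x \in nbrs S v -> y \in H -> adj x y -> 2 < #|nbrs S x|.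
Proof.
move=> xv yH xy; have [x' [y' [v' nx y'H e']]] := two_links cH eH xv.
have [A p] := piece_ex vS cH eH v' y'H e'.
have nx' : x != x' by rewrite eq_sym.
have xA := piece_nbr cH v' y'H p xv nx'.
have : y |: nbrs A x \subset nbrs S x.
  apply/subsetP => w /setU1P[->|]; first by rewrite in_nbrs HS.
  by rewrite !in_nbrs => /andP[/(piece_sub p)[-> _] ->].
move/subset_leq_card; rewrite cardsU1 (piece_nbrs2 p) //.
suff -> : y \notin nbrs A x by [].
rewrite in_nbrs; apply/negP => /andP[/(piece_disjoint v' y'H p)].
by rewrite yH.
Qed.

(** Let [x1 y1] be a link and [K] an exceptional component outside the closed
    neighbourhood of [x1], which consists of [x1], [v], [y1] and a third
    neighbour [w] of [x1].

    If [K] avoids [H], it also avoids the neighbours of [v]: such a vertex would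
    have [v] and two vertices of [K] as neighbours in the piece at [(x1, y1)].
    Then [w] is the only vertex outside [K] with neighbours in it, against
    [no_exceptional_branch].

    If [K] meets [H], it contains all of [H] but [y1].  Each of the two
    neighbours [p], [q] of [y1] on [H] then needs a neighbour in [K] outside
    [H]; by [single_link] these are distinct, hence the other two neighbours
    [x2], [x3] of [v].  Following edges, the piece
    at [(x1, y1)] consists of [v] and vertices of [K] outside [H], at most six
    in total, so it is the triangle [v x2 x3].  But then [x3] has only the
    neighbour [v] in the piece at [(x2, p)]. *)
Lemma no_branching : False.
Proof.
have [x0 x0v] : exists x, x \in nbrs S v by apply/card_gt0P/ltnW/ltnW.
have [x1 [y1 [v1 _ y1H e1]]] := two_links cH eH x0v.
have [A1 p1] := piece_ex vS cH eH v1 y1H e1.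
have x1S := nbrsS v1; have y1S := HS y1H.
have [K cK eK] := exceptional_beyond x1S (linked_degree v1 y1H e1).
have [KS cnK Kcl] := cK; have [_ _ dK] := eK.
have vH := center_notin cH.
have x1v : adj x1 v by rewrite adj_sym in_nbrs_adj.
have KinS w : w \in K -> w \in S by move=> /(subsetP KS)/setDP[].
have Kball w : w \in K -> w \notin ball x1 by move=> /(subsetP KS)/setDP[].
have nK w : w \in S -> adj x1 w -> w \notin K.
  move=> wS x1w; apply/negP => /Kball; by rewrite in_ball wS x1w orbT.
have x1K : x1 \notin K by apply/negP => /Kball; rewrite in_ball eqxx.
have y1K : y1 \notin K by apply: nK.
have vK : v \notin K by apply: nK.
have KA1 k w : w \in A1 -> k \in K -> k \notin H -> adj w k -> k \in A1.
  move=> wA kK kH wk.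
  have [//|kE|/andP[kH' _]] := piece_exit y1H p1 wA (KinS k kK) wk.
    by rewrite -kE kK in x1K.
  by rewrite kH' in kH.
have vA1 : v \in A1 by case: p1.
have [[a /andP[aK aH]]|KH] := pselect (exists a, (a \in K) && (a \in H)); last first.
  have {}KH k : k \in K -> k \notin H.
    by move=> kK; apply/negP => kH; apply: KH; exists k; rewrite kK.
  have KN x : x \in K -> x \notin nbrs S v.
    move=> xK; apply/negP => xv.
    have x1n : x != x1 by apply: contraNneq x1K => <-.
    have xA := piece_nbr cH v1 y1H p1 xv x1n.
    have : v |: nbrs K x \subset nbrs A1 x.
      apply/subsetP => w /setU1P[->|]; first by rewrite in_nbrs vA1 adj_sym (in_nbrs_adj xv).
      rewrite !in_nbrs => /andP[wK xw]; rewrite xw andbT.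
      by apply: (KA1 w x) => //; apply: KH.
    move/subset_leq_card; rewrite cardsU1 (piece_nbrs2 p1) // dK //.
    by rewrite in_nbrs (negPf vK).
  have [w w1 wE] : exists2 w, w \in nbrs S x1 &
      forall z, z \in nbrs S x1 -> [\/ z = v, z = y1 | z = w].
    have : 0 < #|nbrs S x1 :\ v :\ y1|.
      have := linked_degree v1 y1H e1.
      rewrite (cardsD1 v (nbrs S x1)) in_nbrs vS x1v (cardsD1 y1 (nbrs S x1 :\ v)).
      by case: (y1 \in nbrs S x1 :\ v); case: #|_|.
    case/card_gt0P=> w /setD1P[wy /setD1P[wv w1]]; exists w => // z z1.
    apply: contrapT => no.
    have zv : z != v by apply/eqP => E; apply: no; constructor 1.
    have zy : z != y1 by apply/eqP => E; apply: no; constructor 2.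
    have zw : z != w by apply/eqP => E; apply: no; constructor 3.
    have us : uniq [:: z; v; y1; w].
      rewrite /= !inE !negb_or zv zy zw (eq_sym v w) wv (eq_sym y1 w) wy !andbT.
      by apply: contraNneq vH => ->.
    have := @uniq_size_card G (nbrs S x1) _ us.
    rewrite /= z1 w1 !in_nbrs vS x1v y1S e1 => /(_ isT).
    by rewrite ltnNge degree_le3.
  have wS : w \in S := nbrsS w1.
  apply: (no_exceptional_branch wS _ eK); split=> //.
    apply/subsetP => k kK; rewrite !inE KinS // andbT.
    by apply: contraTneq kK => ->; apply: nK => //; move: w1; rewrite in_nbrs => /andP[].
  move=> k z kK /setD1P[zw zS] kz; apply: (Kcl k) => //; rewrite inE zS andbT.
  apply/negP; rewrite in_setU1 => /predU1P[zx|/wE[]zE].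
  - by move: (nK k (KinS k kK)); rewrite -zx adj_sym kz kK => /(_ isT).
  - by move: (KN k kK); rewrite in_nbrs KinS // -zE adj_sym kz.
  - rewrite zE adj_sym in kz.
    have [kH|kN] := component_exit cH y1H (KinS k kK) kz; first by move: (KH k kK); rewrite kH.
    by move: (KN k kK); rewrite kN.
  - by rewrite zE eqxx in zw.
(* the only neighbour of [x1] on [H] is [y1], so [K] spreads over the rest *)
have HK h : h \in H -> h != y1 -> h \in K.
  have [_ cnH d2] := eH.
  have ay : a != y1 by apply: contraNneq y1K => <-.
  apply: (cycle_del_conn cnH d2 y1H aH aK ay) => u w uH uy uK wH wy uw.
  apply: (Kcl u) => //; rewrite inE HS // andbT in_ball HS //= negb_or.
  apply/andP; split; first by apply: contraTneq wH => ->; apply: nbr_notinH v1.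
  by apply: contra wy => x1w; rewrite (single_link v1 wH y1H x1w e1).
have link p : p \in nbrs H y1 ->
    exists2 x, x \in K & [/\ x \in nbrs S v, x != x1 & adj x p].
  rewrite in_nbrs => /andP[pH y1p].
  have pK : p \in K by apply: HK => //; apply: contraTneq y1p => ->; rewrite adj_irr.
  apply: contrapT => no.
  have : y1 |: nbrs K p \subset nbrs H p.
    apply/subsetP => w /setU1P[->|]; first by rewrite in_nbrs y1H adj_sym.
    rewrite !in_nbrs => /andP[wK pw]; rewrite pw andbT.
    have [//|wv] := component_exit cH pH (KinS w wK) pw; case: no; exists w; rewrite // wv adj_sym pw.
    by split=> //; apply: contraNneq x1K => <-.
  move/subset_leq_card; rewrite cardsU1 dK // (cycle_nbrs2 pH).
  by rewrite in_nbrs (negPf y1K).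
have [p [q [pN qN npq]]] : exists p q, [/\ p \in nbrs H y1, q \in nbrs H y1 & p != q].
  by apply/card_gt1P; rewrite cycle_nbrs2.
have [x2 x2K [v2 n21 e2]] := link p pN.
have [x3 x3K [v3' n31 e3]] := link q qN.
move: (pN) (qN); rewrite !in_nbrs => /andP[pH y1p] /andP[qH y1q].
have n23 : x2 != x3.
  by apply: contra_neq npq => E; apply: (single_link v2) => //; rewrite E.
have n12 : x1 != x2 by rewrite eq_sym.
have n13 : x1 != x3 by rewrite eq_sym.
have disj := piece_disjoint v1 y1H p1.
have sub : A1 \subset v |: (K :\: H).
  have [_ [_ [_ cA] _] _ _] := p1.
  apply: (cA _ v) => //; first by rewrite setU11.
  have inZ w : w \in A1 -> w \in K -> w \in v |: (K :\: H).
    by move=> wA wK; rewrite !inE wK (disj w wA) orbT.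
  move=> z w zA /setU1P[zE|/setDP[zK zH]] wA zw.
    rewrite zE in zw.
    have wS : w \in S := (piece_sub p1 wA).1.
    apply: inZ => //.
    have [||->|->//] := nbrs_three v1 v2 v3' n12 n13 n23 (z := w).
    - by rewrite in_nbrs wS.
    - by move=> wE; have := piece_x1 p1; rewrite -wE wA.
    - by [].
  have wS : w \in S := (piece_sub p1 wA).1.
  have [->|wv] := eqVneq w v; first by rewrite setU11.
  apply: inZ => //; have [zv|zv] := boolP (z \in nbrs S v).
    have vz : adj z v by rewrite adj_sym (in_nbrs_adj zv).
    have : v |: nbrs K z \subset nbrs S z.
      apply/subsetP => u /setU1P[->|]; first by rewrite in_nbrs vS.
      by rewrite !in_nbrs => /andP[/KinS-> ->].
    have le3 : #|nbrs S z| <= #|v |: nbrs K z|.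
      by rewrite cardsU1 dK // in_nbrs (negPf vK); apply: degree_le3; apply: nbrsS zv.
    move=> sub; have /eqP E : v |: nbrs K z == nbrs S z by rewrite eqEcard sub.
    have : w \in v |: nbrs K z by rewrite E in_nbrs wS zw.
    by rewrite in_setU1 (negPf wv) in_nbrs => /andP[].
  have : nbrs K z \subset nbrs A1 z.
    apply/subsetP => k; rewrite !in_nbrs => /andP[kK zk]; rewrite zk andbT.
    apply: (KA1 k z) => //; apply: contra zv => kH; rewrite adj_sym in zk.
    by have [zH'|//] := component_exit cH kH (KinS z zK) zk; rewrite zH' in zH.
  move=> sub; have /eqP E : nbrs K z == nbrs A1 z.
    by rewrite eqEcard sub dK // (piece_nbrs2 p1).
  have : w \in nbrs K z by rewrite E in_nbrs wA zw.
  by rewrite in_nbrs => /andP[].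
have pK : p \in K by apply: HK => //; apply: contraTneq y1p => ->; rewrite adj_irr.
have qK : q \in K by apply: HK => //; apply: contraTneq y1q => ->; rewrite adj_irr.
have A13 : #|A1| = 3.
  have [_ [A37 _ _] _ _] := p1; have [K37 _ _] := eK.
  have := subset_leq_card sub; have := (leq_card_setU [set v] (K :\: H)).1.
  have : 1 < #|K :&: H| by apply/card_gt1P; exists p, q; rewrite !inE pK qK pH qH.
  by have := cardsID H K; rewrite cards1; case: A37 K37 => -> [] ->; clear; lia.
have x2A := piece_nbr cH v1 y1H p1 v2 n21.
have x3A := piece_nbr cH v1 y1H p1 v3' n31.
have adj32 : adj x3 x2.
  have [z zA zv] : exists2 z, z \in nbrs A1 x3 & z != v.
    by apply: card2_other; rewrite (piece_nbrs2 p1).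
  move: zA; rewrite in_nbrs => /andP[zA x3z].
  have [<-//|zn2] := eqVneq z x2; have zn3 : z != x3.
    by apply: contraTneq x3z => ->; rewrite adj_irr.
  have us : uniq [:: z; v; x2; x3].
    by rewrite /= !inE !negb_or zv zn2 zn3 n23 (eq_sym v x2) (nbr_neq v2) eq_sym (nbr_neq v3').
  by have := @uniq_size_card G A1 _ us; rewrite /= zA vA1 x2A x3A A13 => /(_ isT).
have [A2 p2] := piece_ex vS cH eH v2 pH e2.
have n32 : x3 != x2 by rewrite eq_sym.
have x3A2 := piece_nbr cH v2 pH p2 v3' n32.
have [z zA zv] : exists2 z, z \in nbrs A2 x3 & z != v.
  by apply: card2_other; rewrite (piece_nbrs2 p2).
move: zA; rewrite in_nbrs => /andP[zA x3z].
have zq : z != q by apply: contraTneq qH => <-; apply: piece_disjoint p2 zA.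
have zn2 : z != x2 by apply: contraTneq zA => ->; apply: piece_x1 p2.
have us : uniq [:: z; v; x2; q].
  rewrite /= !inE !negb_or zv zn2 zq (eq_sym v x2) (nbr_neq v2) !andbT /=.
  apply/andP; split; first by apply: contraNneq vH => ->.
  by apply: contraTneq qH => <-; apply: nbr_notinH v2.
have x3v : adj x3 v by rewrite adj_sym in_nbrs_adj.
have := @uniq_size_card G (nbrs S x3) _ us; rewrite /= !in_nbrs vS x3v (HS qH) e3.
rewrite (nbrsS v2) adj32 x3z (piece_sub p2 zA).1 => /(_ isT).
by rewrite ltnNge (degree_le3 (nbrsS v3')).
Qed.

End Claws.

Lemma degree_le2 v : v \in S -> #|nbrs S v| <= 2.
Proof.
move=> vS; rewrite leqNgt; apply/negP => v3.
by have [H cH eH] := exceptional_beyond vS v3; apply: (no_branching vS v3 cH eH).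
Qed.

End Minimal.

(** * Connected sets of maximum degree two *)

Section MaxDegree2.
Variables (G : sgraph) (S : {set G}).
Hypothesis conS : conn_set S.
Hypothesis IH : forall R : {set G}, #|R| < #|S| -> conn_set R -> ~ exceptional R -> isolable R.
Hypothesis degree_le2 : forall x, x \in S -> #|nbrs S x| <= 2.
Implicit Types (x y z u v w : G) (A D K R X : {set G}).

(** A proper subset of [S] has no exceptional component, as its vertices would
    have no further neighbours in [S]. *)
Lemma isolate_rest R D0 :
  R \proper S ->
  exists2 D : {set G}, 4 * #|D| <= #|R| & sparse (R :\: closed_nbhd (D0 :|: D)).
Proof.
case/properP=> RS [s sS sR]; apply: isolate_components => K [KR cK _]; left.
have KS := subset_trans KR RS.
have Kne : K <> S by move=> E; move/subsetP: KR => /(_ s); rewrite E sS (negPf sR) => /(_ isT).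
apply: IH => //; first by apply: proper_card; rewrite properEneq KS andbT; apply/eqP.
by move=> eK; apply/Kne/exceptional_maximal => // x /(subsetP KS)/degree_le2.
Qed.

(** The inequality says that rounding to a multiple of four leaves room for
    [u]; fewer than four vertices in [X] may suffice. *)
Lemma isolable_without u X :
  u \in X -> X \subset S -> (forall w, w \in X -> w = u \/ adj u w) ->
  4 * ((#|S| - #|X|) %/ 4).+1 <= #|S| -> isolable S.
Proof.
move=> uX XS Xu le; have RS : S :\: X \proper S.
  rewrite properE subsetDl; apply/subsetPn; exists u; first exact: (subsetP XS).
  by rewrite inE uX.
have [D DR sp] := isolate_rest [set u] RS.
apply: (isolable_extend XS Xu _ sp).
by move: DR; rewrite cardsD (setIidPr XS); lia.
Qed.

Lemma nbrs_only u a b w :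
  u \in S -> a \in S -> b \in S -> w \in S -> a != b ->
  adj u a -> adj u b -> adj u w -> w = a \/ w = b.
Proof.
move=> uS aS bS wS ab ua ub uw.
by apply: (card2_mem (degree_le2 uS)); rewrite ?in_nbrs ?aS ?bS ?wS.
Qed.

Lemma seq_neq (x0 : G) (q : seq G) i j :
  uniq q -> i < size q -> j < size q -> i != j -> nth x0 q i != nth x0 q j.
Proof. by move=> uq iq jq; rewrite nth_uniq. Qed.

(** On a path [q0 .. q8], the vertices [q1] and [q7] dominate all but
    [q3 q4 q5], which is a small component of its own: two vertices for
    nine. *)
Lemma isolable_long : 8 < #|S| -> isolable S.
Proof.
move=> S9.
have [q0 [p [szp pp up pS]]] := path_grow conS degree_le2 S9.
case: p szp pp up pS => [//|q1 [//|q2 [//|q3 [//|q4 [//|q5 [//|q6 [//|q7 [//|q8 [|//]]]]]]]]] _.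
move=> /= /and5P[e01 e12 e23 e34 /and5P[e45 e56 e67 e78 _]] up.
move=> /and5P[S0 S1 S2 S3 /and5P[S4 S5 S6 S7 /andP[S8 _]]].
pose q := [:: q0; q1; q2; q3; q4; q5; q6; q7; q8].
have uq : uniq q by [].
have neq i j : i < 9 -> j < 9 -> i != j -> nth q0 q i != nth q0 q j := @seq_neq q0 q i j uq.
have qS : [set z in q] \subset S.
  have qA : all (mem S) q by rewrite /= S0 S1 S2 S3 S4 S5 S6 S7 S8.
  by apply/subsetP => z; rewrite inE; apply: (allP qA).
pose R := S :\: [set z in q].
have cardR : #|S| = 9 + #|R|.
  have := subset_leq_card qS.
  by rewrite cardsD (setIidPr qS) cardsE (card_uniqP uq) => /subnKC.
have RS : R \proper S.
  rewrite properE subsetDl; apply/subsetPn; exists q0 => //.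
  by rewrite !in_set mem_head.
have [D DR sp] := isolate_rest [set q1; q7] RS.
exists ([set q1; q7] :|: D).
  have := (leq_card_setU [set q1; q7] D).1.
  by rewrite cards2; move: DR cardR; case: (_ != _); clear; lia.
set N := closed_nbhd _.
have Nq z d : d \in [set q1; q7] -> z = d \/ adj d z -> z \in N.
  move=> dD dz; apply: (subsetP (nbhdS (subsetUl _ _))).
  by case: dz => [->|dz]; [apply: nbhd_in|apply: nbhd_adj dz].
have d1 : q1 \in [set q1; q7] by rewrite !inE eqxx.
have d7 : q7 \in [set q1; q7] by rewrite !inE eqxx orbT.
have N0 : q0 \in N by apply: (Nq _ q1) => //; right; rewrite adj_sym.
have N1 : q1 \in N by apply: (Nq _ q1) => //; left.
have N2 : q2 \in N by apply: (Nq _ q1) => //; right.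
have N6 : q6 \in N by apply: (Nq _ q7) => //; right; rewrite adj_sym.
have N7 : q7 \in N by apply: (Nq _ q7) => //; left.
have N8 : q8 \in N by apply: (Nq _ q7) => //; right.
apply: (@sparseS _ _ ([set q3; q4; q5] :|: (R :\: N))).
  apply/subsetP => z /setDP[zS zN]; rewrite in_setU in_setD zN in_setD zS !andbT /=.
  case: (boolP (z \in [set _ in q])) => [|_]; last by rewrite orbT.
  rewrite orbF in_set /q !in_cons => zq; rewrite !inE.
  case/predU1P: zq => [E|]; first by rewrite E N0 in zN.
  case/predU1P=> [E|]; first by rewrite E N1 in zN.
  case/predU1P=> [E|]; first by rewrite E N2 in zN.
  case/predU1P=> [->|]; first by rewrite eqxx.
  case/predU1P=> [->|]; first by rewrite eqxx orbT.
  case/predU1P=> [->|]; first by rewrite eqxx !orbT.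
  case/predU1P=> [E|]; first by rewrite E N6 in zN.
  case/predU1P=> [E|]; first by rewrite E N7 in zN.
  by case/predU1P=> [E|//]; rewrite E N8 in zN.
have on3 w : w \in S -> adj q3 w -> w = q2 \/ w = q4.
  by move=> wS; apply: nbrs_only => //; [apply: (neq 2 4)|rewrite adj_sym].
have on4 w : w \in S -> adj q4 w -> w = q3 \/ w = q5.
  by move=> wS; apply: nbrs_only => //; [apply: (neq 3 5)|rewrite adj_sym].
have on5 w : w \in S -> adj q5 w -> w = q4 \/ w = q6.
  by move=> wS; apply: nbrs_only => //; [apply: (neq 4 6)|rewrite adj_sym].
apply: sparseU => //.
- move=> x y x345 /setDP[/setDP[yS yq] yN]; apply/negP => xy.
  have inq i : i < 9 -> y = nth q0 q i -> False.
    by move=> i9 E; rewrite E in_set mem_nth in yq.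
  move: x345; rewrite !inE -orbA => /or3P[] /eqP E; rewrite E in xy.
  + by case: (on3 y yS xy); [apply: (inq 2)|apply: (inq 4)].
  + by case: (on4 y yS xy); [apply: (inq 3)|apply: (inq 5)].
  + by case: (on5 y yS xy); [apply: (inq 4)|apply: (inq 6)].
apply: sparse3.
  by apply: leq_trans (leq_card_setU _ _) _; rewrite cards1 cards2; case: (_ != _).
right; exists q3; first by rewrite !inE eqxx.
rewrite -(cards1 q4); apply/subset_leq_card/subsetP => w.
rewrite in_nbrs => /andP[w345 q3w]; rewrite in_set1.
have wS : w \in S by move: w345; rewrite !inE => /orP[/orP[]|] /eqP->.
have [E|->//] := on3 w wS q3w; move: w345; rewrite E !inE.
by rewrite (negPf (neq 2 3 isT isT isT)) (negPf (neq 2 4 isT isT isT))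
  (negPf (neq 2 5 isT isT isT)).
Qed.

(** The middle vertex of a spanning path leaves the first two and the last two
    vertices, and its ends are not adjacent as there is no 7-cycle. *)
Lemma isolable_seven : #|S| = 7 -> ~ exceptional S -> isolable S.
Proof.
move=> S7 nE.
have [|q0 [p [szp pp up pS]]] := path_grow conS degree_le2 (k := 6); first by rewrite S7.
case: p szp pp up pS => [//|q1 [//|q2 [//|q3 [//|q4 [//|q5 [//|q6 [|//]]]]]]] _.
move=> /= /and5P[e01 e12 e23 e34 /and3P[e45 e56 _]] up.
move=> /and5P[s0 s1 s2 s3 /and4P[s4 s5 s6 _]].
pose q := [:: q0; q1; q2; q3; q4; q5; q6].
have uq : uniq q by [].
have neq i j : i < 7 -> j < 7 -> i != j -> nth q0 q i != nth q0 q j := @seq_neq q0 q i j uq.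
have qS : all (mem S) q by rewrite /= s0 s1 s2 s3 s4 s5 s6.
have Sq z : z \in S -> z \in q.
  move=> zS; apply: contraT => zq.
  have /(_ S)/= := @uniq_size_card G _ (z :: q); rewrite zq up S7 zS s0 s1 s2 s3 s4 s5 s6.
  by move=> /(_ isT isT).
have n06 : ~~ adj q0 q6.
  apply/negP => e06; apply: nE; split=> //; first by right.
  have two u a b : u \in S -> a \in S -> b \in S -> a != b -> adj u a -> adj u b ->
      #|nbrs S u| = 2.
    move=> uS aS bS ab ua ub; apply/eqP; rewrite eqn_leq degree_le2 //=.
    by apply: (@uniq_size_card G _ [:: a; b]); rewrite /= ?inE ?ab // aS bS ua ub.
  move=> z /Sq; rewrite /q !in_cons.
  case/predU1P=> [->|]; first by apply: (two _ q1 q6) => //; apply: (neq 1 6).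
  case/predU1P=> [->|]; first by apply: (two _ q0 q2) => //; [apply: (neq 0 2)|rewrite adj_sym].
  case/predU1P=> [->|]; first by apply: (two _ q1 q3) => //; [apply: (neq 1 3)|rewrite adj_sym].
  case/predU1P=> [->|]; first by apply: (two _ q2 q4) => //; [apply: (neq 2 4)|rewrite adj_sym].
  case/predU1P=> [->|]; first by apply: (two _ q3 q5) => //; [apply: (neq 3 5)|rewrite adj_sym].
  case/predU1P=> [->|]; first by apply: (two _ q4 q6) => //; [apply: (neq 4 6)|rewrite adj_sym].
  case/predU1P=> [->|//]; apply: (two _ q5 q0) => //; first exact: (neq 5 0).
    by rewrite adj_sym.
  by rewrite adj_sym.
have on1 w : w \in S -> adj q1 w -> w = q0 \/ w = q2.
  by move=> wS; apply: nbrs_only => //; [apply: (neq 0 2)|rewrite adj_sym].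
have on5 w : w \in S -> adj q5 w -> w = q4 \/ w = q6.
  by move=> wS; apply: nbrs_only => //; [apply: (neq 4 6)|rewrite adj_sym].
exists [set q3]; first by rewrite cards1 S7.
apply: (@sparseS _ _ ([set q0; q1] :|: [set q5; q6])).
  apply/subsetP => z /setDP[/Sq]; rewrite nbhd1E negb_or /q !in_cons !inE -!orbA.
  case/predU1P=> [->|]; first by rewrite eqxx.
  case/predU1P=> [->|]; first by rewrite eqxx orbT.
  case/predU1P=> [->|]; first by rewrite adj_sym e23 andbF.
  case/predU1P=> [->|]; first by rewrite eqxx.
  case/predU1P=> [->|]; first by rewrite e34 andbF.
  case/predU1P=> [->|]; first by rewrite eqxx !orbT.
  by case/predU1P=> [->|//]; rewrite eqxx !orbT.
have small (a b : G) : sparse [set a; b].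
  have le2 : #|[set a; b]| <= 2 by rewrite cards2; case: (_ != _).
  by apply: sparse3; [apply: ltnW|left].
apply: sparseU => // x y; rewrite !inE => /orP[]/eqP-> /orP[]/eqP-> //.
- apply/negP => e05; rewrite adj_sym in e05; case: (on5 _ s0 e05) => /eqP.
    by rewrite (negPf (neq 0 4 isT isT isT)).
  by rewrite (negPf (neq 0 6 isT isT isT)).
- apply/negP => e15; case: (on1 _ s5 e15) => /eqP.
    by rewrite (negPf (neq 5 0 isT isT isT)).
  by rewrite (negPf (neq 5 2 isT isT isT)).
- apply/negP => e16; case: (on1 _ s6 e16) => /eqP.
    by rewrite (negPf (neq 6 0 isT isT isT)).
  by rewrite (negPf (neq 6 2 isT isT isT)).
Qed.

(** For 4, 5, 6 and 8 vertices, a vertex with two neighbours leaves 1, 2, 3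
    and 5 vertices, none a multiple of four, so that rounding pays for the
    vertex. *)
Lemma isolable_degree2 : ~ exceptional S -> isolable S.
Proof.
move=> nE; have [S3|S4] := leqP #|S| 3.
  exists set0; first by rewrite cards0.
  apply: sparseS (subsetDl _ _) _; apply: sparse3 => //.
  have [S2|] := leqP #|S| 2; [by left|right].
  apply: contrapT => no; apply: nE; split=> //; first by left; lia.
  move=> x xS; have := degree_le2 xS; rewrite leq_eqVlt => /orP[/eqP//|x1].
  by case: no; exists x.
have [/isolable_long//|S8] := ltnP 8 #|S|.
have [S7|S7] := eqVneq #|S| 7; first exact: isolable_seven.
have [|x [p [szp pp up pS]]] := path_grow conS degree_le2 (k := 2); first lia.
case: p szp pp up pS => [//|y [//|z [|//]]] _ /= /and3P[xy yz _] up /and4P[xS yS zS _].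
have us : uniq [:: x; y; z] by [].
apply: (@isolable_without y [set w in [:: x; y; z]]).
- by rewrite !inE eqxx orbT.
- by apply/subsetP => w; rewrite !inE => /or3P[]/eqP->.
- move=> w; rewrite !inE => /or3P[]/eqP->; [right|by left|by right].
  by rewrite adj_sym.
- rewrite cardsE (card_uniqP us) /=; move: S4 S8 S7.
  by case: #|S| => [|[|[|[|[|[|[|[|[|n]]]]]]]]].
Qed.

End MaxDegree2.

Lemma connected_isolable (G : sgraph) (S : {set G}) :
  conn_set S -> ~ exceptional S -> isolable S.
Proof.
elim: {S}_.+1 {-2}S (ltnSn #|S|) => // n IHn S Sn cS nE.
have IH (R : {set G}) : #|R| < #|S| -> conn_set R -> ~ exceptional R -> isolable R.
  by move=> RS; apply: IHn; lia.
apply: contrapT => nS; apply: (nS); apply: isolable_degree2 => // x xS.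
exact: (degree_le2 cS IH nS).
Qed.

(** * From sparse sets to isolating sets *)

Lemma adj_connect_sym (G : sgraph) : connect_sym (@adj G).
Proof. exact: sym_connect_sym (@adj_sym G). Qed.

Lemma connected_full (G : sgraph) (A : {set G}) x :
  connected G -> x \in A -> (forall y z, y \in A -> adj y z -> z \in A) -> forall y, y \in A.
Proof.
move=> [_ cG] xA cl y.
have clA : closed adj (mem A).
  by apply: (intro_closed (@adj_connect_sym G)) => u w uw uA; apply: cl uw.
by rewrite -(closed_connect clA (cG x y)).
Qed.

Lemma connected_conn_set (G : sgraph) : connected G -> conn_set [set: G].
Proof.
move=> cG; split; first by case/card_gt0P: (cG.1) => x _; exists x; rewrite inE.
move=> A x _ xA cl; apply/subsetP => y _.
by apply: (connected_full cG xA) => u w uA uw; apply: (cl u); rewrite ?inE.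
Qed.

Lemma edge_in (G : sgraph) (E : {set {set G}}) :
  (forall x y : G, adj x y -> [set x; y] \in E) -> edges G \subset E.
Proof.
move=> h; apply/subsetP => s /imsetP[[x y]]; rewrite inE /= => xy ->; exact: h.
Qed.

(** A connected graph satisfying the local condition of [sparse] is spanned by
    a path with two edges, or by a single edge when no such path exists. *)
Lemma sparse_isolating (G : sgraph) (D : {set G}) :
  sparse (~: closed_nbhd D) -> isolating 3 D.
Proof.
move=> sp H [cH H3] [f fi fh].
have spH (a b c d : H) : a != c -> adj a b -> adj b c ->
    (adj a d -> d = b) /\ (adj b d -> d = a \/ d = c).
  move=> ac ab bc; have inC z : val (f z) \in ~: closed_nbhd D by rewrite inE; apply: (valP (f z)).
  have ac' : val (f a) != val (f c) by rewrite val_eqE inj_eq.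
  have [h1 h2] := sp _ _ _ _ (inC a) (inC b) (inC c) (inC d) ac' (fh _ _ ab) (fh _ _ bc).
  split=> [/fh/h1|/fh/h2[]] /val_inj/fi; [by []|by left|by right].
have [[a [b [c [ac ab bc]]]]|no] :=
    pselect (exists a b c : H, [/\ a != c, adj a b & adj b c]).
  have cb : adj c b by rewrite adj_sym.
  have ba : adj b a by rewrite adj_sym.
  have ca : c != a by rewrite eq_sym.
  have Na d : adj a d -> d = b by case: (spH a b c d ac ab bc).
  have Nc d : adj c d -> d = b by case: (spH c b a d ca cb ba).
  have Nb d : adj b d -> d = a \/ d = c by case: (spH a b c d ac ab bc).
  have all3 z : z \in [set a; b; c].
    apply: (connected_full (x := a) cH); first by rewrite !inE eqxx.
    move=> x y; rewrite !inE => /orP[/orP[]|] /eqP->.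
    - by move/Na->; rewrite eqxx orbT.
    - by move/Nb => [] ->; rewrite eqxx ?orbT.
    - by move/Nc->; rewrite eqxx orbT.
  have /subset_leq_card : edges H \subset [set [set a; b]; [set b; c]].
    apply: edge_in => x y; move: (all3 x); rewrite !inE => /orP[/orP[]|] /eqP->.
    - by move/Na->; rewrite eqxx.
    - by move/Nb => [] ->; rewrite ?eqxx ?orbT // setUC eqxx.
    - by move/Nc->; rewrite (setUC [set c]) eqxx orbT.
  by rewrite cards2 => /(leq_trans H3); case: (_ != _).
have /card_gt0P[s] : 0 < #|edges H| by apply: leq_trans H3.
case/imsetP=> -[a b]; rewrite inE /= => ab _.
have Na d : adj a d -> d = b.
  move=> ad; apply: contrapT => /eqP db; apply: no; exists d, a, b; split=> //.
  by rewrite adj_sym.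
have Nb d : adj b d -> d = a.
  move=> bd; apply: contrapT => /eqP da; apply: no; exists a, b, d; split=> //.
  by rewrite eq_sym.
have all2 z : z \in [set a; b].
  apply: (connected_full (x := a) cH); first by rewrite !inE eqxx.
  by move=> x y; rewrite !inE => /orP[] /eqP-> => [/Na|/Nb] ->; rewrite eqxx ?orbT.
have /subset_leq_card : edges H \subset [set [set a; b]].
  apply: edge_in => x y; move: (all2 x); rewrite !inE => /orP[] /eqP->.
    by move/Na->.
  by move/Nb->; rewrite setUC.
by rewrite cards1 => /(leq_trans H3).
Qed.

Lemma isolation_number_le (k : nat) (G : sgraph) (D : {set G}) :
  isolating k D -> isolation_number k G <= #|D|.
Proof.
move=> iD; rewrite /isolation_number; case: arg_minnP => [|D' _ min].
  by apply/asboolP; apply: isolating_setT.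
by apply: min; apply/asboolP.
Qed.

Lemma isolation_number_ex (k : nat) (G : sgraph) :
  exists2 D : {set G}, isolating k D & isolation_number k G = #|D|.
Proof.
rewrite /isolation_number; case: arg_minnP => [|D iD _].
  by apply/asboolP; apply: isolating_setT.
by exists D => //; apply/asboolP.
Qed.

(** * Recognising the triangle and the 7-cycle *)

Lemma isomorphic_inv (G H : sgraph) (g : H -> G) :
  bijective g -> (forall x y, adj (g x) (g y) = adj x y) -> isomorphic G H.
Proof.
move=> [f gK fK] mg; exists f; first by exists g.
by move=> x y; rewrite -mg !fK.
Qed.

(** On three vertices, degree two means adjacent to all others.  On seven, a
    spanning cycle already accounts for both neighbours of each vertex, so
    there are no chords. *)
Lemma exceptional_isomorphic (G : sgraph) :
  exceptional [set: G] ->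
  isomorphic G (complete_graph 3) \/ isomorphic G (cycle_graph 7).
Proof.
case=> [[] G37 cG d2].
  left; rewrite cardsT in G37.
  pose f (x : G) : complete_graph 3 := cast_ord G37 (enum_rank x).
  have fi : injective f by move=> x y /cast_ord_inj/enum_rank_inj.
  exists f; first by apply: inj_card_bij; rewrite ?card_ord ?G37.
  move=> x y; rewrite {1}/adj /= /sym_rel andbT (inj_eq fi).
  have E : nbrs [set: G] x = ~: [set x].
    apply/eqP; rewrite eqEcard d2 ?inE // cardsC1 G37 andbT.
    by apply/subsetP => z; rewrite !inE /=; apply: contraTneq => ->; rewrite adj_irr.
  by have := congr1 (fun A : {set G} => y \in A) E; rewrite !inE /= eq_sym => ->.
right; have [y _] := cG.1; have [c [pc uc Ec]] := ham_cycle cG d2 (in_setT y).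
have sc : size (y :: c) = 7.
  by rewrite -(card_uniqP uc) -(eq_card Ec).
have d2' (u a b w : G) : a != b -> adj u a -> adj u b -> adj u w = (w == a) || (w == b).
  move=> ab ua ub; apply/idP/orP => [uw|[]/eqP-> //].
  have nE z : (z \in nbrs [set: G] u) = adj u z by rewrite in_nbrs in_setT.
  have u2 : #|nbrs [set: G] u| <= 2 by rewrite d2 ?in_setT.
  have [] := @card2_mem _ _ a b w u2; rewrite ?nE // => ->; rewrite eqxx; by [left|right].
pose g (i : cycle_graph 7) := nth y (y :: c) i.
have gi : injective g.
  move=> i j /eqP; rewrite /g nth_uniq ?sc ?ltn_ord // => /eqP; exact: val_inj.
apply: (@isomorphic_inv _ _ g).
  by apply: inj_card_bij => //; rewrite card_ord -cardsT G37.
have step i : i < 6 -> adj (nth y (y :: c) i) (nth y (y :: c) i.+1).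
  move: pc; rewrite /= rcons_path => /andP[/(pathP y) pc _] i6.
  by apply: pc; move: sc => /= [->].
have back : adj (nth y (y :: c) 6) (nth y (y :: c) 0).
  move: pc; rewrite /= rcons_path => /andP[_]; rewrite (last_nth y).
  by move: sc => /= [->].
have Ng (i j k l : nat) : i < 7 -> j < 7 -> k < 7 -> l < 7 -> j != k ->
   adj (nth y (y :: c) i) (nth y (y :: c) j) -> adj (nth y (y :: c) i) (nth y (y :: c) k) ->
   adj (nth y (y :: c) i) (nth y (y :: c) l) = (l == j) || (l == k).
  move=> i7 j7 k7 l7 jk ij ik.
  by rewrite (d2' _ _ _ _ _ ij ik) !nth_uniq ?sc.
move=> [i i7] [j j7]; rewrite /g /=.
have S' k : k < 6 -> adj (nth y (y :: c) k.+1) (nth y (y :: c) k).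
  by move=> k6; rewrite adj_sym; apply: step.
have back' : adj (nth y (y :: c) 0) (nth y (y :: c) 6) by rewrite adj_sym.
case: i i7 => [|[|[|[|[|[|[|//]]]]]]] i7.
- rewrite (Ng 0 6 1 j) //; last exact: step.
  by case: j j7 => [|[|[|[|[|[|[|//]]]]]]].
- rewrite (Ng 1 0 2 j) //; [|exact: S'|exact: step].
  by case: j j7 => [|[|[|[|[|[|[|//]]]]]]].
- rewrite (Ng 2 1 3 j) //; [|exact: S'|exact: step].
  by case: j j7 => [|[|[|[|[|[|[|//]]]]]]].
- rewrite (Ng 3 2 4 j) //; [|exact: S'|exact: step].
  by case: j j7 => [|[|[|[|[|[|[|//]]]]]]].
- rewrite (Ng 4 3 5 j) //; [|exact: S'|exact: step].
  by case: j j7 => [|[|[|[|[|[|[|//]]]]]]].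
- rewrite (Ng 5 4 6 j) //; [|exact: S'|exact: step].
  by case: j j7 => [|[|[|[|[|[|[|//]]]]]]].
- rewrite (Ng 6 5 0 j) //; [|exact: S'].
  by case: j j7 => [|[|[|[|[|[|[|//]]]]]]].
Qed.

(** * The extremal graph and the bound *)

Lemma triangle_E3 : E_family 3 (complete_graph 3).
Proof.
split; first split.
- by rewrite card_ord.
- move=> x y; have [->|xy] := eqVneq x y; first exact: connect0.
  by apply: connect1; rewrite /adj /= /sym_rel xy.
have inE3 (x y : complete_graph 3) : x != y -> [set x; y] \in edges (complete_graph 3).
  by move=> xy; apply/imsetP; exists (x, y); rewrite // inE /adj /= /sym_rel xy.
pose o0 : complete_graph 3 := @Ordinal 3 0 isT.
pose o1 : complete_graph 3 := @Ordinal 3 1 isT.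
pose o2 : complete_graph 3 := @Ordinal 3 2 isT.
have us : uniq [:: [set o0; o1]; [set o0; o2]; [set o1; o2]].
  rewrite /= !inE negb_or !andbT; apply/andP; split; first (apply/andP; split).
  - by apply/eqP => /setP/(_ o1); rewrite !inE.
  - by apply/eqP => /setP/(_ o0); rewrite !inE.
  - by apply/eqP => /setP/(_ o0); rewrite !inE.
by apply: (uniq_size_card us); rewrite /= !inE3.
Qed.

(** Every neighbour of the triangle attached to [inl i] is [inl i] or in the
    triangle, so a set missing these four vertices leaves the triangle intact.
    The blocks are disjoint, and there are [a] of them. *)
Lemma BK3_lower (G : sgraph) (a b : nat) :
  isomorphic G (graph_of_rel (@BK3_rel a b)) -> a <= isolation_number 3 G.
Proof.
case=> f [g fK gK] mf; have [D iD ->] := isolation_number_ex 3 G.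
pose blk (z : 'I_b + 'I_a * complete_graph 3) (i : 'I_a) :=
  match z with inl j => j == i :> nat | inr (i', _) => i' == i end.
have hit (i : 'I_a) : exists d, (d \in D) && blk (f d) i.
  apply: contrapT => no; apply: (iD _ triangle_E3).
  pose t u : G := g (inr (i, u)).
  have tN u : t u \notin closed_nbhd D.
    rewrite inE negb_or; apply/andP; split.
      by apply/negP => tD; apply: no; exists (t u); rewrite tD gK /blk eqxx.
    apply/existsP => -[d /andP[dD dt]]; apply: no; exists d; rewrite dD /=.
    move: dt; rewrite -mf gK /adj /= /sym_rel => /andP[_].
    case: (f d) => [j|[i' w]] /=; first by rewrite orbF.
    by case/orP=> /andP[/eqP-> _].
  exists (fun u => exist _ (t u) (tN u)).
    by move=> u w [] /(can_inj gK) [].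
  move=> u w uw; change (adj (t u) (t w)); rewrite -mf !gK.
  change (sym_rel (@BK3_rel a b) (inr (i, u)) (inr (i, w))).
  apply/andP; split; last by rewrite /= eqxx; apply/orP; left.
  by apply: contraTneq uw => -[->]; rewrite adj_irr.
have [h hP] := choice hit.
have hi : injective h.
  move=> i j E; have /andP[_] := hP i; have /andP[_] := hP j; rewrite E /blk.
  case: (f (h j)) => [k|[k w]]; last by move=> /eqP<- /eqP<-.
  by move=> /eqP kj /eqP ki; apply: val_inj; rewrite /= -ki -kj.
rewrite -[a]card_ord -(card_imset _ hi); apply/subset_leq_card/subsetP => _ /imsetP[i _ ->].
by have /andP[] := hP i.
Qed.

Theorem theorem4 (G : sgraph) (n : nat) (G_order : #|G| = n)
    (G_connected : connected G)
    (G_not_triangle : ~ isomorphic G (complete_graph 3))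
    (G_not_7cycle : ~ isomorphic G (cycle_graph 7)) :
  isolation_number 3 G <= n %/ 4 /\
  (isomorphic G (BK3 n) -> isolation_number 3 G = n %/ 4).
Proof.
have upper : isolation_number 3 G <= n %/ 4.
  have [|D DG sp] := connected_isolable (connected_conn_set G_connected).
    by case/exceptional_isomorphic.
  rewrite -G_order; apply: (@leq_trans #|D|).
    by apply/isolation_number_le/sparse_isolating; rewrite -setTD.
  by rewrite leq_divRL // mulnC -cardsT.
split=> // iso; apply/eqP; rewrite eqn_leq upper /=.
move: iso; rewrite /BK3; case: leqP => [n3 _|_ /BK3_lower //].
by rewrite divn_small.
Qed.
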